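(* Let $\alpha\in\mathbb{C}$, let $P^+(4)$ be the Poisson superalgebra of differential operators on $S^{1|2}$, let $\rho_\alpha:\Gamma(2,-1-\alpha,\alpha-1)\to P^+(4)$ be the embedding with image $\Gamma_\alpha$ (as in the context), and let $\Gamma_\alpha$ act on $P^+(4)$ by the Poisson bracket. Then $\dim H^1(\Gamma_\alpha,P^+(4))=1$. The space $H^1(\Gamma_\alpha,P^+(4))$ is spanned by the class of the 1-cocycle $\theta_1:\Gamma_\alpha\to P^+(4)$ that vanishes on the basis elements not listed and is given by $$\theta_1(D_\alpha^1)=t^{-1}\xi_1,\quad \theta_1(D_\alpha^2)=t^{-1}\xi_2,\quad \theta_1(D_\alpha^3)=t^{-1}\eta_1,\quad \theta_1(D_\alpha^4)=t^{-1}\eta_2,$$ $$\theta_1(F_\alpha^1)=2t^{-1}\tau,\quad \theta_1(H_\alpha^1)=1.$$ Moreover, the infinitesimal deformation $\rho_\alpha+\beta\theta_1$ defined by $\theta_1$ corresponds to a formal deformation of the embedding $\rho_\alpha$ into $P^+(4)$; that is, there is a formal deformation $\tilde\rho_\beta=\rho_\alpha+\sum_{k\ge1}\beta^k\rho_k$ of $\rho_\alpha$ with values in $P^+(4)$ and with $\rho_1=\theta_1$ (where $\Gamma(2,-1-\alpha,\alpha-1)$ is identified with $\Gamma_\alpha$ via $\rho_\alpha$).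
   Context: All vector spaces are over $\mathbb{C}$; $p$ denotes parity. **Poisson superalgebra $P^+(4)$.** Let $P^+$ be the commutative algebra of polynomials in $\tau$ with coefficients in $\mathbb{C}[t,t^{-1}]$, i.e. of finite sums $\sum_{i=0}^{n}a_i(t)\tau^i$, $a_i(t)\in\mathbb{C}[t,t^{-1}]$. Let $\Lambda(4)$ be the Grassmann algebra on odd generators $\xi_1,\xi_2,\eta_1,\eta_2$, and $P^+(4)=P^+\otimes\Lambda(4)$, with $t,\tau$ even. The Poisson bracket on $P^+(4)$ is $$\{A,B\}=\partial_\tau A\,\partial_tB-\partial_tA\,\partial_\tau B+(-1)^{p(A)+1}\sum_{i=1}^{2}\left(\partial_{\xi_i}A\,\partial_{\eta_i}B+\partial_{\eta_i}A\,\partial_{\xi_i}B\right)$$ with left derivatives in the odd variables; this makes $P^+(4)$ a Lie superalgebra. **The subsuperalgebra $\Gamma_\alpha$ and the embedding $\rho_\alpha$.** For $\alpha\in\mathbb{C}$, $\Gamma_\alpha\subset P^+(4)$ is the Lie subsuperalgebra with basis $$E_\alpha^1=t^2,\quad F_\alpha^1=\tau^2-2\alpha t^{-2}\xi_1\xi_2\eta_1\eta_2,\quad H_\alpha^1=t\tau,$$ $$E_\alpha^2=\xi_1\xi_2,\quad F_\alpha^2=\eta_1\eta_2,\quad H_\alpha^2=\xi_1\eta_1+\xi_2\eta_2,$$ $$E_\alpha^3=\xi_1\eta_2,\quad F_\alpha^3=\xi_2\eta_1,\quad H_\alpha^3=\xi_1\eta_1-\xi_2\eta_2,$$ $$T_\alpha^1=t\eta_1,\quad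 T_\alpha^2=t\eta_2,\quad T_\alpha^3=t\xi_1,\quad T_\alpha^4=t\xi_2,$$ $$D_\alpha^1=\tau\xi_1+\alpha t^{-1}\xi_1\xi_2\eta_2,\quad D_\alpha^2=\tau\xi_2-\alpha t^{-1}\xi_1\xi_2\eta_1,$$ $$D_\alpha^3=\tau\eta_1+\alpha t^{-1}\xi_2\eta_1\eta_2,\quad D_\alpha^4=\tau\eta_2-\alpha t^{-1}\xi_1\eta_1\eta_2.$$ It is isomorphic to the Lie superalgebra $\Gamma(2,-1-\alpha,\alpha-1)$ from Scheunert's family $\Gamma(\sigma_1,\sigma_2,\sigma_3)$, $\sigma_1+\sigma_2+\sigma_3=0$ (even part $\mathfrak{sl}(2)^{\oplus3}$, odd part the tensor product of the three standard two-dimensional modules); $\rho_\alpha$ denotes the embedding of $\Gamma(2,-1-\alpha,\alpha-1)$ with image $\Gamma_\alpha$. Identifying $\Gamma(2,-1-\alpha,\alpha-1)$ with $\Gamma_\alpha$, $\rho_\alpha$ is simply the inclusion $\Gamma_\alpha\hookrightarrow P^+(4)$. **Cohomology.** For a Lie superalgebra $\mathfrak{g}$ and a Lie superalgebra $\mathfrak{h}\supset\mathfrak{g}$, viewed as a $\mathfrak{g}$-module via the bracket, $H^1(\mathfrak{g},\mathfrak{h})$ is the usual first cohomology: 1-cocycles are sums of homogeneous linear maps $c:\mathfrak{g}\to\mathfrak{h}$ with $c([X,Y])=(-1)^{p(c)p(X)}[X,c(Y)]-(-1)^{p(Y)(p(X)+p(c))}[Y,c(X)]$ for homogeneous $X,Y$;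 1-coboundaries are sums of maps $X\mapsto(-1)^{p(X)p(v)}[X,v]$ with $v\in\mathfrak{h}$ homogeneous; $H^1$ is the quotient of cocycles by coboundaries. **Deformations.** For an embedding $\rho:\mathfrak{g}\to\mathfrak{h}$ of Lie superalgebras and an even 1-cocycle $\rho_1$, the map $\rho+\beta\rho_1$ is a homomorphism up to terms quadratic in $\beta$ and is called an infinitesimal deformation. A formal deformation of $\rho$ is a series $\tilde\rho_\beta=\rho+\sum_{k\ge1}\beta^k\rho_k$, with $\rho_k:\mathfrak{g}\to\mathfrak{h}$ even linear maps, satisfying $\tilde\rho_\beta([X,Y])=[\tilde\rho_\beta(X),\tilde\rho_\beta(Y)]$ for all $X,Y\in\mathfrak{g}$ (as an identity of power series in $\beta$). *)

(* Defs.v *)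
From HB Require Import structures.
From mathcomp Require Import all_boot all_order all_algebra.
From mathcomp Require Import boolp functions reals.
From mathcomp Require Import finmap complex monalg.

Set Implicit Arguments.
Unset Strict Implicit.
Unset Printing Implicit Defensive.

Import Order.TTheory GRing.Theory Num.Theory.
Local Open Scope ring_scope.

(* The quotient Z / B of two subspaces of V, each given by its membership
   predicate, is handled through representatives. *)
Section Quotient.
Context (F : fieldType) (V : lmodType F).
Implicit Types Z B : V -> Prop.

Definition generates_mod Z B n (e : 'I_n -> V) : Prop :=
  (forall i, Z (e i)) /\
  forall z, Z z -> exists a : 'I_n -> F, B (z - \sum_i a i *: e i).

Definition free_mod B n (e : 'I_n -> V) : Prop :=
  forall a : 'I_n -> F, B (\sum_i a i *: e i) -> forall i, a i = 0.

Definition dim_quotient Z B (n : nat) : Prop :=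
  exists e : 'I_n -> V, generates_mod Z B e /\ free_mod B e.

End Quotient.

(* iota embeds the Lie superalgebra g into h; [pg p X] says that X is
   homogeneous of parity p (true being odd), so that 0 has both parities. *)
Section Cohomology.
Context (F : fieldType) (g h : lmodType F).
Context (pg : bool -> g -> Prop) (ph : bool -> h -> Prop).
Context (brg : g -> g -> g) (brh : h -> h -> h) (iota : g -> h).

Definition homog_map (b : bool) (c : g -> h) : Prop :=
  forall p X, pg p X -> ph (p (+) b) (c X).

Definition homog_cocycle (b : bool) (c : {linear g -> h}) : Prop :=
  homog_map b c /\
  forall p q X Y, pg p X -> pg q Y ->
    c (brg X Y) = (-1) ^+ (b && p) *: brh (iota X) (c Y)
                - (-1) ^+ (q && (p (+) b)) *: brh (iota Y) (c X).

Definition homog_coboundary (b : bool) (c : {linear g -> h}) : Prop :=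
  exists2 v, ph b v &
  forall p X, pg p X -> c X = (-1) ^+ (p && b) *: brh (iota X) v.

Definition cocycle (c : g -> h) : Prop :=
  exists c0 c1 : {linear g -> h},
    [/\ homog_cocycle false c0, homog_cocycle true c1 & c = c0 \+ c1].

Definition coboundary (c : g -> h) : Prop :=
  exists c0 c1 : {linear g -> h},
    [/\ homog_coboundary false c0, homog_coboundary true c1 & c = c0 \+ c1].

(* rho k is the coefficient of beta^k; the last clause is the coefficient of
   beta^n in the homomorphism identity. *)
Definition formal_deformation (rho : nat -> {linear g -> h}) : Prop :=
  [/\ rho 0%N =1 iota,
      forall k, homog_map false (rho k)
    & forall n X Y,
        rho n (brg X Y) = \sum_(i < n.+1) brh (rho i X) (rho (n - i)%N Y)].

End Cohomology.

(* (a, b, S) stands for t^a tau^b xi_S, where xi_S is the product of the odd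
   generators indexed by S in increasing order, the generators being listed
   as xi_1, xi_2, eta_1, eta_2. *)
Notation Pmon := (int * nat * {set 'I_(2 + 2)})%type.
Notation P4 F := {malg F[Pmon]}.

Section Poisson.
Context (F : fieldType).
Implicit Types (A B : P4 F) (S T : {set 'I_(2 + 2)}) (k l : Pmon).

Definition mono (a : int) (b : nat) S : P4 F := << ((a, b, S) : Pmon) >>.

(* linear extension of f from the monomials *)
Definition lin_ext (f : Pmon -> P4 F) A : P4 F := \sum_(k <- msupp A) A@_k *: f k.

(* xi_S xi_T = (-1)^(inversions S T) xi_(S u T) for disjoint S and T *)
Definition inversions S T : nat := (\sum_(i in S) \sum_(j in T) (j < i))%N.

Definition mono_mul k l : P4 F :=
  if [disjoint k.2 & l.2] then
    (-1) ^+ inversions k.2 l.2 *: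
      mono (k.1.1 + l.1.1) (k.1.2 + l.1.2) (k.2 :|: l.2)
  else 0.

Definition pmul A B : P4 F := lin_ext (fun k => lin_ext (mono_mul k) B) A.

Definition d_t : P4 F -> P4 F :=
  lin_ext (fun k => k.1.1%:~R *: mono (k.1.1 - 1) k.1.2 k.2).

Definition d_tau : P4 F -> P4 F :=
  lin_ext (fun k => k.1.2%:R *: mono k.1.1 k.1.2.-1 k.2).

(* left derivative in the i-th odd generator *)
Definition d_odd (i : 'I_(2 + 2)) : P4 F -> P4 F :=
  lin_ext (fun k => if i \in k.2 then
                   (-1) ^+ inversions [set i] k.2 *: mono k.1.1 k.1.2 (k.2 :\ i)
                 else 0).

Definition d_xi (i : 'I_2) := d_odd (lshift 2 i).
Definition d_eta (i : 'I_2) := d_odd (rshift 2 i).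

Definition homogP (p : bool) A : Prop := forall k, A@_k != 0 -> odd #|k.2| = p.

(* A |-> (-1)^p(A) A, extended linearly from homogeneous A *)
Definition parity_sign : P4 F -> P4 F :=
  lin_ext (fun k => (-1) ^+ odd #|k.2| *: mono k.1.1 k.1.2 k.2).

Definition pbracket A B : P4 F :=
  pmul (d_tau A) (d_t B) - pmul (d_t A) (d_tau B)
  - \sum_(i < 2) (pmul (d_xi i (parity_sign A)) (d_eta i B)
                  + pmul (d_eta i (parity_sign A)) (d_xi i B)).

Definition tpow (a : int) : P4 F := mono a 0 set0.
Definition tau : P4 F := mono 0 1 set0.
Definition gen_xi (i : 'I_2) : P4 F := mono 0 0 [set lshift 2 i].
Definition gen_eta (i : 'I_2) : P4 F := mono 0 0 [set rshift 2 i].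

End Poisson.

Section Linearity.
Context (F : fieldType).
Implicit Types (A B : P4 F).

Lemma lin_ext_wide (d : {fset Pmon}) (f : Pmon -> P4 F) A :
  (msupp A `<=` d)%fset -> lin_ext f A = \sum_(k <- d) A@_k *: f k.
Proof.
move=> le; rewrite /lin_ext (big_fset_incl _ le) // => k _ /mcoeff_outdom ->.
by rewrite scale0r.
Qed.

Fact lin_ext_linear (f : Pmon -> P4 F) : linear (lin_ext f).
Proof.
move=> c A B; pose d := (msupp A `|` msupp B `|` msupp (c *: A + B))%fset.
rewrite !(@lin_ext_wide d) ?scaler_sumr -?big_split /=.
- by apply: eq_bigr => k _; rewrite mcoeffD mcoeffZ scalerDl scalerA.
- by rewrite /d -fsetUA fsetUCA fsubsetUl.
- by rewrite /d -fsetUA fsubsetUl.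
- by rewrite /d fsubsetUr.
Qed.

HB.instance Definition _ f :=
  GRing.isLinear.Build F (P4 F) (P4 F) *:%R (lin_ext f) (lin_ext_linear f).

Lemma lin_ext_mono f a b S : lin_ext f (mono F a b S) = f (a, b, S).
Proof.
rewrite /lin_ext /mono msuppU oner_eq0 big_seq_fset1.
by rewrite mcoeffUU scale1r.
Qed.

Fact pmul_linearl B : linear (fun A => pmul A B).
Proof. by move=> c A A'; rewrite /pmul linearP. Qed.

Fact pmul_linearr A : linear (pmul A).
Proof.
move=> c B B'; rewrite /pmul {1 3 5}/lin_ext scaler_sumr -big_split /=.
apply: eq_bigr => k _.
by rewrite linearP scalerDr !scalerA [c * _]mulrC.
Qed.

Let linD (f g : P4 F -> P4 F) :
  linear f -> linear g -> linear (fun A => f A + g A).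
Proof. by move=> fl gl c A B; rewrite fl gl scalerDr addrACA. Qed.

Let linN (f : P4 F -> P4 F) : linear f -> linear (fun A => - f A).
Proof. by move=> fl c A B; rewrite fl opprD scalerN. Qed.

Let lin_sum n (f : 'I_n -> P4 F -> P4 F) :
  (forall i, linear (f i)) -> linear (fun A => \sum_i f i A).
Proof.
move=> fl c A B; rewrite scaler_sumr -big_split /=.
by apply: eq_bigr => i _; rewrite fl.
Qed.

Lemma linear_comb (f : P4 F -> P4 F) (I : finType) (a : I -> F) e :
  linear f -> f (\sum_i a i *: e i) = \sum_i a i *: f (e i).
Proof.
move=> fl; apply: (big_rec2 (fun A B => f A = B)) => [|i A B _ <-]; last exact: fl.
by have := fl (-1) 0 0; rewrite scaler0 addr0 scaleN1r addNr.
Qed.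

Fact pbracket_linearl B : linear (fun A => pbracket A B).
Proof.
have pl (f : P4 F -> P4 F) C : linear f -> linear (fun A => pmul (f A) C).
  by move=> fl c A A'; rewrite fl pmul_linearl.
have po i : linear (fun A => d_odd i (parity_sign A)).
  by move=> c A A'; rewrite /d_odd /parity_sign !linearP.
apply: linD; first by apply: linD; [|apply: linN]; apply: pl; apply: lin_ext_linear.
by apply/linN/lin_sum => i; apply: linD; apply: pl; apply: po.
Qed.

Fact pbracket_linearr A : linear (pbracket A).
Proof.
have pr (f : P4 F -> P4 F) C : linear f -> linear (fun B => pmul C (f B)).
  by move=> fl c B B'; rewrite fl pmul_linearr.
apply: linD; first by apply: linD; [|apply: linN]; apply: pr; apply: lin_ext_linear.
by apply/linN/lin_sum => i; apply: linD; apply: pr; apply: lin_ext_linear.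
Qed.

End Linearity.

Local Infix "**" := pmul (at level 40, left associativity).
Local Notation t := (tpow _ 1).
Local Notation "'t^-1'" := (tpow _ (- 1)) (at level 0).
Local Notation "'t^-2'" := (tpow _ (- 2)) (at level 0).
Local Notation xi1 := (gen_xi _ 0).
Local Notation xi2 := (gen_xi _ 1).
Local Notation eta1 := (gen_eta _ 0).
Local Notation eta2 := (gen_eta _ 1).

Variant gindex :=
  | E1 | F1 | H1 | E2 | F2 | H2 | E3 | F3 | H3
  | T1 | T2 | T3 | T4 | D1 | D2 | D3 | D4.

Definition gindices : seq gindex :=
  [:: E1; F1; H1; E2; F2; H2; E3; F3; H3; T1; T2; T3; T4; D1; D2; D3; D4].

Definition gindex_code (i : gindex) : 'I_17 :=
  inord match i with
  | E1 => 0 | F1 => 1 | H1 => 2 | E2 => 3 | F2 => 4 | H2 => 5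
  | E3 => 6 | F3 => 7 | H3 => 8 | T1 => 9 | T2 => 10 | T3 => 11
  | T4 => 12 | D1 => 13 | D2 => 14 | D3 => 15 | D4 => 16
  end.

Lemma gindex_codeK : cancel gindex_code (nth E1 gindices).
Proof. by case; rewrite /= inordK. Qed.

HB.instance Definition _ := Finite.copy gindex (can_type gindex_codeK).

Section Gamma.
Context (F : numFieldType) (alpha : F).

Definition gbasis (i : gindex) : P4 F :=
  match i with
  | E1 => t ** t
  | F1 => tau F ** tau F - (2 * alpha) *: (t^-2 ** xi1 ** xi2 ** eta1 ** eta2)
  | H1 => t ** tau F
  | E2 => xi1 ** xi2
  | F2 => eta1 ** eta2
  | H2 => xi1 ** eta1 + xi2 ** eta2
  | E3 => xi1 ** eta2
  | F3 => xi2 ** eta1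
  | H3 => xi1 ** eta1 - xi2 ** eta2
  | T1 => t ** eta1
  | T2 => t ** eta2
  | T3 => t ** xi1
  | T4 => t ** xi2
  | D1 => tau F ** xi1 + alpha *: (t^-1 ** xi1 ** xi2 ** eta2)
  | D2 => tau F ** xi2 - alpha *: (t^-1 ** xi1 ** xi2 ** eta1)
  | D3 => tau F ** eta1 + alpha *: (t^-1 ** xi2 ** eta1 ** eta2)
  | D4 => tau F ** eta2 - alpha *: (t^-1 ** xi1 ** eta1 ** eta2)
  end.

Definition in_gamma : {pred P4 F} :=
  fun A => `[< exists a : gindex -> F, A = \sum_i a i *: gbasis i >].

Fact in_gamma_submod_closed : submod_closed in_gamma.
Proof.
split=> [|c A B /asboolP[a ->] /asboolP[b ->]]; apply/asboolP.
  by exists (fun=> 0); rewrite big1 // => i _; rewrite scale0r.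
exists (fun i => c * a i + b i); rewrite scaler_sumr -big_split /=.
by apply: eq_bigr => i _; rewrite scalerDl scalerA.
Qed.

HB.instance Definition _ :=
  GRing.isSubmodClosed.Build F (P4 F) in_gamma in_gamma_submod_closed.

Record gamma := Gamma { gval :> P4 F; gvalP : gval \in in_gamma }.

HB.instance Definition _ := [isSub for gval].
HB.instance Definition _ := [Choice of gamma by <:].
HB.instance Definition _ := [SubChoice_isSubLmodule of gamma by <:].

Fact gbasis_in (i : gindex) : gbasis i \in in_gamma.
Proof.
apply/asboolP; exists (fun j => (i == j)%:R).
rewrite (bigD1 i) //= eqxx scale1r big1 ?addr0 // => j ji.
by rewrite eq_sym (negPf ji) scale0r.
Qed.

Definition gelt (i : gindex) : gamma := Gamma (gbasis_in i).

End Gamma.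

(* Closure of gamma under the bracket, by computing with lists of terms
   (c, e, (a, b, s)) denoting c alpha^e t^a tau^b xi_S, where the boolean list s
   is the characteristic function of S. *)
Module GammaClosed.
Section Computation.
Context (F : numFieldType) (alpha : F).

Let key := (int * nat * seq bool)%type.
Let rep := seq (int * nat * key).

Definition bset (s : seq bool) : {set 'I_(2 + 2)} :=
  [set i : 'I_(2 + 2) | nth false s i].
Definition kmono (k : key) : P4 F := mono F k.1.1 k.1.2 (bset k.2).
Definition ev (r : rep) : P4 F :=
  \sum_(x <- r) (x.1.1%:~R * alpha ^+ x.1.2) *: kmono x.2.

Lemma ev_cat r s : ev (r ++ s) = ev r + ev s.
Proof. exact: big_cat. Qed.

Lemma ev_cons x r :
  ev (x :: r) = (x.1.1%:~R * alpha ^+ x.1.2) *: kmono x.2 + ev r.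
Proof. exact: big_cons. Qed.

Definition rscale (c : int) (e : nat) (r : rep) : rep :=
  [seq ((c * x.1.1)%R, (e + x.1.2)%N, x.2) | x <- r].

Lemma ev_scale c e r : ev (rscale c e r) = (c%:~R * alpha ^+ e) *: ev r.
Proof.
rewrite /ev big_map scaler_sumr; apply: eq_bigr => x _ /=.
by rewrite scalerA intrM exprD mulrACA.
Qed.

Definition rlift (f : key -> rep) (r : rep) : rep :=
  flatten [seq rscale x.1.1 x.1.2 (f x.2) | x <- r].

Lemma ev_lift f g r : (forall k, g (k.1.1, k.1.2, bset k.2) = ev (f k)) ->
  lin_ext g (ev r) = ev (rlift f r).
Proof.
move=> fg; elim: r => [|x r IH]; first by rewrite /ev !big_nil raddf0.
rewrite /rlift /= ev_cat -/(rlift _ _) -IH ev_cons linearP.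
by rewrite ev_scale -fg -lin_ext_mono.
Qed.

Definition count_inv (s u : seq bool) : nat :=
  sumn [seq (nth false s i *
    sumn [seq (nth false u j * (j < i))%N | j <- iota 0 4])%N | i <- iota 0 4].

Lemma inversions_bset s u : inversions (bset s) (bset u) = count_inv s u.
Proof.
rewrite /inversions /count_inv big_mkcond.
rewrite sumnE big_map -[iota 0 4]/(index_iota 0 4) big_mkord; apply: eq_bigr => i _.
rewrite inE; case: nth; rewrite (mul0n, mul1n) // big_mkcond.
rewrite sumnE big_map big_mkord; apply: eq_bigr => j _.
by rewrite inE; case: nth; rewrite (mul0n, mul1n).
Qed.

Definition runit (i : nat) := mkseq (fun j => j == i) 4.
Lemma bset_unit (i : 'I_(2 + 2)) : [set i] = bset (runit i).
Proof.
by apply/setP => j; rewrite !inE nth_mkseq //.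
Qed.

Definition runion (s u : seq bool) :=
  mkseq (fun j => nth false s j || nth false u j) 4.
Lemma bset_union s u : bset s :|: bset u = bset (runion s u).
Proof. by apply/setP => j; rewrite !inE nth_mkseq. Qed.

Definition rdel (s : seq bool) i :=
  mkseq (fun j => (j != i) && nth false s j) 4.
Lemma bset_del s (i : 'I_(2 + 2)) : bset s :\ i = bset (rdel s i).
Proof. by apply/setP => j; rewrite !inE nth_mkseq. Qed.

Definition rdisj (s u : seq bool) :=
  all (fun j => ~~ (nth false s j && nth false u j)) (iota 0 4).
Lemma bset_disj s u : [disjoint bset s & bset u] = rdisj s u.
Proof.
rewrite disjoints_subset; apply/subsetP/allP => [H j|H j].
  rewrite mem_iota /= => lj; have := H (Ordinal lj); rewrite !inE /=.
  by case: nth => //= ->.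
by have := H j; rewrite mem_iota !inE => /(_ (ltn_ord j)); case: nth.
Qed.

Lemma card_bset s : #|bset s| = sumn [seq nat_of_bool (nth false s i) | i <- iota 0 4].
Proof.
rewrite -sum1_card big_mkcond sumnE big_map -[iota 0 4]/(index_iota 0 4).
by rewrite big_mkord; apply: eq_bigr => i _; rewrite inE; case: nth.
Qed.

Lemma ev1 c k : ev [:: (c, 0%N, k)] = c%:~R *: kmono k.
Proof. by rewrite ev_cons /ev big_nil addr0 mulr1. Qed.

Lemma ev_nil : ev [::] = 0. Proof. exact: big_nil. Qed.

Definition rsign (n : nat) : int := if odd n then -1 else 1.
Lemma rsignE n : (rsign n)%:~R = (-1) ^+ n :> F.
Proof. by rewrite -signr_odd /rsign; case: odd. Qed.

Definition kmul (k l : key) : rep :=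
  if rdisj k.2 l.2 then
    [:: (rsign (count_inv k.2 l.2), 0%N,
         (k.1.1 + l.1.1, (k.1.2 + l.1.2)%N, runion k.2 l.2))] else [::].
Definition rmul (r s : rep) : rep := rlift (fun k => rlift (kmul k) s) r.
Lemma ev_mul r s : pmul (ev r) (ev s) = ev (rmul r s).
Proof.
apply: ev_lift => k; apply: ev_lift => l.
rewrite /mono_mul /kmul /= bset_disj; case: ifP => _; last by rewrite ev_nil.
by rewrite ev1 rsignE inversions_bset bset_union.
Qed.

Definition rdt : rep -> rep :=
  rlift (fun k => [:: (k.1.1, 0%N, (k.1.1 - 1, k.1.2, k.2))]).
Lemma ev_dt r : d_t (ev r) = ev (rdt r).
Proof. by apply: ev_lift => k; rewrite ev1. Qed.

Definition rdtau : rep -> rep :=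
  rlift (fun k => [:: (k.1.2%:Z, 0%N, (k.1.1, k.1.2.-1, k.2))]).
Lemma ev_dtau r : d_tau (ev r) = ev (rdtau r).
Proof. by apply: ev_lift => k; rewrite ev1. Qed.

Definition rdodd (i : nat) : rep -> rep :=
  rlift (fun k => if nth false k.2 i then
    [:: (rsign (count_inv (runit i) k.2), 0%N, (k.1.1, k.1.2, rdel k.2 i))]
    else [::]).
Lemma ev_dodd i r : d_odd i (ev r) = ev (rdodd i r).
Proof.
apply: ev_lift => k; rewrite inE; case: ifP => _; last by rewrite ev_nil.
by rewrite ev1 rsignE bset_del bset_unit inversions_bset.
Qed.

Definition rpar : rep -> rep :=
  rlift (fun k => [:: (rsign (sumn [seq nat_of_bool (nth false k.2 i) | i <- iota 0 4]),
    0%N, k)]).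
Lemma ev_par r : parity_sign (ev r) = ev (rpar r).
Proof.
by apply: ev_lift => k; rewrite ev1 rsignE card_bset /= signr_odd.
Qed.

Definition rbr (r s : rep) : rep :=
  rmul (rdtau r) (rdt s) ++ rscale (-1) 0
   (rmul (rdt r) (rdtau s) ++
   (rmul (rdodd 0 (rpar r)) (rdodd 2 s) ++ rmul (rdodd 2 (rpar r)) (rdodd 0 s)) ++
   (rmul (rdodd 1 (rpar r)) (rdodd 3 s) ++ rmul (rdodd 3 (rpar r)) (rdodd 1 s))).
Lemma ev_br r s : pbracket (ev r) (ev s) = ev (rbr r s).
Proof.
rewrite /rbr /pbracket big_ord_recl big_ord1 /d_xi /d_eta.
rewrite ev_par !ev_dodd !ev_dtau !ev_dt !ev_mul.
by rewrite !ev_cat ev_scale !ev_cat mulr1 rmorphN1 scaleN1r !opprD !addrA.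
Qed.

Definition rzero (r : rep) : bool :=
  all (fun k => foldr +%R 0 [seq x.1.1 | x <- r & (x.1.2, x.2) == k] == 0)
    [seq (x.1.2, x.2) | x <- r].

Lemma ev_zero r : rzero r -> ev r = 0.
Proof.
move=> /allP r0; pose tk (x : int * nat * key) := (x.1.2, x.2).
have -> : ev r = \sum_(k <- undup (map tk r))
                   (foldr +%R 0 [seq x.1.1 | x <- r & tk x == k])%:~R *:
                     (alpha ^+ k.1 *: kmono k.2).
  transitivity (\sum_(k <- undup (map tk r)) \sum_(x <- r | tk x == k)
      (x.1.1%:~R * alpha ^+ x.1.2) *: kmono x.2).
    rewrite (exchange_big_dep xpredT) //= /ev; apply: eq_big_seq => x xr.
    rewrite (eq_bigl (pred1 (tk x))) => [|k]; last exact: eq_sym.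
    rewrite -big_filter filter_pred1_uniq ?undup_uniq ?big_seq1 //.
    by rewrite mem_undup map_f.
  apply: eq_bigr => k _; rewrite foldrE big_map big_filter.
  rewrite rmorph_sum scaler_suml; apply: eq_bigr => x /eqP <-.
  by rewrite scalerA.
rewrite big_seq big1 // => k; rewrite mem_undup => /r0 /eqP.
by rewrite /tk => ->; rewrite scale0r.
Qed.

Definition rt (a : int) : rep := [:: (1, 0%N, (a, 0%N, nseq 4 false))].
Definition rtau : rep := [:: (1, 0%N, (0, 1%N, nseq 4 false))].
Definition rodd (i : nat) : rep := [:: (1, 0%N, (0, 0%N, runit i))].

Lemma bset0 : bset (nseq 4 false) = set0.
Proof. by apply/setP => i; rewrite !inE nth_nseq if_same. Qed.
Lemma ev_t a : tpow F a = ev (rt a).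
Proof. by rewrite ev1 scale1r /kmono bset0. Qed.
Lemma ev_tau : tau F = ev rtau.
Proof. by rewrite ev1 scale1r /kmono bset0. Qed.
Lemma ev_xi i : gen_xi F i = ev (rodd i).
Proof. by rewrite ev1 scale1r /kmono -(bset_unit (lshift 2 i)). Qed.
Lemma ev_eta i : gen_eta F i = ev (rodd (2 + i)).
Proof. by rewrite ev1 scale1r /kmono -(bset_unit (rshift 2 i)). Qed.

Section Template.
Context (V : Type) (add mul : V -> V -> V) (scale : int -> nat -> V -> V).
Context (tp : int -> V) (ta : V) (od : nat -> V).
Local Infix "+v" := add (at level 50, left associativity).
Local Infix "*v" := mul (at level 40, left associativity).

Definition gbasis_with (i : gindex) : V :=
  match i with
  | E1 => tp 1 *v tp 1
  | F1 => ta *v ta +v scale (-2) 1%N (tp (-2) *v od 0 *v od 1 *v od 2 *v od 3)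
  | H1 => tp 1 *v ta
  | E2 => od 0 *v od 1
  | F2 => od 2 *v od 3
  | H2 => od 0 *v od 2 +v od 1 *v od 3
  | E3 => od 0 *v od 3
  | F3 => od 1 *v od 2
  | H3 => od 0 *v od 2 +v scale (-1) 0%N (od 1 *v od 3)
  | T1 => tp 1 *v od 2
  | T2 => tp 1 *v od 3
  | T3 => tp 1 *v od 0
  | T4 => tp 1 *v od 1
  | D1 => ta *v od 0 +v scale 1 1%N (tp (-1) *v od 0 *v od 1 *v od 3)
  | D2 => ta *v od 1 +v scale (-1) 1%N (tp (-1) *v od 0 *v od 1 *v od 2)
  | D3 => ta *v od 2 +v scale 1 1%N (tp (-1) *v od 1 *v od 2 *v od 3)
  | D4 => ta *v od 3 +v scale (-1) 1%N (tp (-1) *v od 0 *v od 2 *v od 3)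
  end.
End Template.

Lemma gbasis_withE (V W : Type) (f : V -> W) addV mulV scaleV tV tauV oddV
    addW mulW scaleW :
  {morph f : x y / addV x y >-> addW x y} ->
  {morph f : x y / mulV x y >-> mulW x y} ->
  (forall c e, {morph f : x / scaleV c e x >-> scaleW c e x}) ->
  forall i, f (gbasis_with addV mulV scaleV tV tauV oddV i) =
            gbasis_with addW mulW scaleW (f \o tV) (f tauV) (f \o oddV) i.
Proof. by move=> fD fM fZ; case; rewrite /= ?fD ?fZ ?fM. Qed.

Definition rgb : gindex -> rep :=
  gbasis_with cat rmul rscale rt rtau rodd.

Lemma ev_gb i : gbasis alpha i = ev (rgb i).
Proof.
pose sc c e (A : P4 F) := (c%:~R * alpha ^+ e) *: A.
rewrite (gbasis_withE (f := ev) _ _ _ ev_cat (fun r s => esym (ev_mul r s))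
  (scaleW := sc) ev_scale).
have N2 : (-2 : int)%:~R = - 2%:R :> F by exact: mulrNz.
have N1 : (-1 : int)%:~R = - 1 :> F by exact: mulrNz.
case: i; rewrite /gbasis_with /gbasis /comp /sc -?ev_t -?ev_tau
  -?(ev_xi 0) -?(ev_xi 1) -?(ev_eta 0) -?(ev_eta 1)
  ?N2 ?N1 ?mulr1 ?mul1r ?mulN1r ?expr1 ?mulNr ?scaleNr ?scale1r; reflexivity.
Qed.

Definition ru (i : gindex) : rep :=
  match i with
  | H2 => rmul (rodd 0) (rodd 2)
  | H3 => rmul (rodd 1) (rodd 3)
  | i => rgb i
  end.

Lemma half_in (A B : P4 F) : A + B \in in_gamma alpha ->
  A - B \in in_gamma alpha -> A \in in_gamma alpha /\ B \in in_gamma alpha.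
Proof.
move=> sAB dAB; have two : 2%:R != 0 :> F by rewrite pnatr_eq0.
rewrite -[A](scalerK two) -[B](scalerK two) !scaler_nat !mulr2n.
split; apply: rpredZ.
  by have -> : A + A = A + B + (A - B); [rewrite addrACA subrr addr0|exact: rpredD].
have -> : B + B = A + B - (A - B) by rewrite opprB [RHS]addrC addrA addrNK.
exact: rpredB.
Qed.

Lemma ru_in i : ev (ru i) \in in_gamma alpha.
Proof.
have [h2 h3] := half_in (gbasis_in alpha H2) (gbasis_in alpha H3).
have e2 : ev (ru H2) = xi1 ** eta1.
  transitivity (pmul (ev (rodd 0)) (ev (rodd 2))); first exact/esym/ev_mul.
  exact: (congr2 (@pmul F) (esym (ev_xi 0)) (esym (ev_eta 0))).
have e3 : ev (ru H3) = xi2 ** eta2.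
  transitivity (pmul (ev (rodd 1)) (ev (rodd 3))); first exact/esym/ev_mul.
  exact: (congr2 (@pmul F) (esym (ev_xi 1)) (esym (ev_eta 1))).
rewrite -e2 in h2; rewrite -e3 in h3.
by case: i => //; rewrite /ru -ev_gb; apply: gbasis_in.
Qed.

Definition lead (i : gindex) : key :=
  let b0 := nseq 4 false in
  match i with
  | E1 => (2, 0%N, b0)
  | F1 => (0, 2%N, b0)
  | H1 => (1, 1%N, b0)
  | E2 => (0, 0%N, [:: true; true; false; false])
  | F2 => (0, 0%N, [:: false; false; true; true])
  | H2 => (0, 0%N, [:: true; false; true; false])
  | E3 => (0, 0%N, [:: true; false; false; true])
  | F3 => (0, 0%N, [:: false; true; true; false])
  | H3 => (0, 0%N, [:: false; true; false; true])
  | T1 => (1, 0%N, runit 2)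
  | T2 => (1, 0%N, runit 3)
  | T3 => (1, 0%N, runit 0)
  | T4 => (1, 0%N, runit 1)
  | D1 => (0, 1%N, runit 0)
  | D2 => (0, 1%N, runit 1)
  | D3 => (0, 1%N, runit 2)
  | D4 => (0, 1%N, runit 3)
  end.

Definition rproj (r : rep) : rep :=
  flatten [seq flatten [seq rscale x.1.1 x.1.2 (ru i) | x <- r & x.2 == lead i]
             | i <- gindices].

Lemma ev_flatten_in rs : (forall r, r \in rs -> ev r \in in_gamma alpha) ->
  ev (flatten rs) \in in_gamma alpha.
Proof.
elim: rs => [|r rs IH] H /=; first by rewrite ev_nil rpred0.
rewrite ev_cat; apply: rpredD; first exact/H/mem_head.
by apply: IH => s ss; apply: H; rewrite inE ss orbT.
Qed.

Lemma rproj_in r : ev (rproj r) \in in_gamma alpha.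
Proof.
apply: ev_flatten_in => _ /mapP[i _ ->]; apply: ev_flatten_in => _ /mapP[x _ ->].
by rewrite ev_scale rpredZ // ru_in.
Qed.

Lemma gbracket_check : all (fun i => all (fun j =>
  let r := rbr (rgb i) (rgb j) in rzero (r ++ rscale (-1) 0 (rproj r)))
    gindices) gindices.
Proof. by vm_compute. Qed.

Lemma mem_gindices i : i \in gindices.
Proof. by rewrite -(gindex_codeK i) mem_nth ?ltn_ord. Qed.

Lemma gbasis_bracket_in i j :
  pbracket (gbasis alpha i) (gbasis alpha j) \in in_gamma alpha.
Proof.
have /allP/(_ _ (mem_gindices i))/allP/(_ _ (mem_gindices j)) := gbracket_check.
rewrite /= => /ev_zero; rewrite ev_cat ev_scale mulr1 rmorphN1 scaleN1r.
by rewrite !ev_gb ev_br => /subr0_eq ->; exact: rproj_in.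
Qed.

End Computation.
End GammaClosed.

Section GammaCohomology.
Context (F : numFieldType) (alpha : F).
Local Notation gamma := (gamma alpha).
Implicit Types X Y : gamma.

Fact gbracket_in X Y : pbracket (gval X) (gval Y) \in in_gamma alpha.
Proof.
have /asboolP[a ->] := gvalP X; have /asboolP[b ->] := gvalP Y.
rewrite (linear_comb _ _ (@pbracket_linearl _ _)) rpred_sum // => i _; apply: rpredZ.
rewrite (linear_comb _ _ (@pbracket_linearr _ _)) rpred_sum // => j _; apply: rpredZ.
exact: GammaClosed.gbasis_bracket_in.
Qed.

Definition gbracket X Y : gamma := Gamma (gbracket_in X Y).

Definition homogG (p : bool) X : Prop := homogP p (gval X).

Definition cocycles1 : (gamma -> P4 F) -> Prop :=
  cocycle homogG (@homogP F) gbracket (@pbracket F) (@gval F alpha).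

Definition coboundaries1 : (gamma -> P4 F) -> Prop :=
  coboundary homogG (@homogP F) (@pbracket F) (@gval F alpha).

Definition dim_H1 (n : nat) : Prop := dim_quotient cocycles1 coboundaries1 n.

Definition spans_H1 (c : gamma -> P4 F) : Prop :=
  generates_mod cocycles1 coboundaries1 (fun _ : 'I_1 => c).

Definition even_cocycle1 (c : {linear gamma -> P4 F}) : Prop :=
  homog_cocycle homogG (@homogP F) gbracket (@pbracket F) (@gval F alpha) false c.

(* The abstract algebra being identified with gamma, rho_alpha is gval. *)
Definition deforms_rho (rho : nat -> {linear gamma -> P4 F}) : Prop :=
  formal_deformation homogG (@homogP F) gbracket (@pbracket F) (@gval F alpha) rho.

End GammaCohomology.

Definition theta1_value (F : numFieldType) (i : gindex) : P4 F :=
  match i with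
  | D1 => t^-1 ** xi1
  | D2 => t^-1 ** xi2
  | D3 => t^-1 ** eta1
  | D4 => t^-1 ** eta2
  | F1 => 2 *: (t^-1 ** tau F)
  | H1 => tpow F 0
  | _ => 0
  end.

(* Main.v *)
(* A cocycle is normalised step by step. E1 = t^2 acts by -2 t d_tau, which is
   onto, so a coboundary makes the cocycle vanish on E1. The values on T1, ..., T4
   then lie in ker d_tau, where these elements act as t times the four odd
   derivatives, and a Koszul homotopy removes them. What is left at H1 is a Laurent
   polynomial in t; up to a coboundary it is a constant, which a multiple of theta1
   cancels. A cocycle vanishing on E1, T1, ..., T4 and H1 is zero: it vanishes on
   E2, ..., H3, which act trivially on C[t, 1/t] and span a perfect algebra, then on
   the odd elements D_j by their weight and [D_j, D_j] = 0, and finally on F1, which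
   is [D1, D3]. No value of alpha is special. The class of theta1 is not zero since
   the constants are not in the image of H1.

   theta1 is the restriction of L = t^-1 d_tau, an outer derivation of the Poisson
   superalgebra generating the automorphisms tau |-> tau + beta / t, so exp (beta L)
   restricts to the required formal deformation. *)
From HB Require Import structures.
Require Import Defs.
From mathcomp Require Import all_boot all_order all_algebra.
From mathcomp Require Import boolp functions reals.
From mathcomp Require Import finmap complex monalg.
From mathcomp Require Import zify.

Set Implicit Arguments.
Unset Strict Implicit.
Unset Printing Implicit Defensive.

Import Order.TTheory GRing.Theory Num.Theory.
Local Open Scope ring_scope.

(* Conversion between distinct terms built from the operations of P4 does not
   terminate in practice, so that unification has to see them sealed. *)
HB.lock Definition pmon (F : fieldType) (a : int) (b : nat) (S : {set 'I_(2 + 2)}) :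
  P4 F := mono F a b S.
HB.lock Definition pprod (F : fieldType) (A B : P4 F) : P4 F := pmul A B.
HB.lock Definition pdt (F : fieldType) (A : P4 F) : P4 F := d_t A.
HB.lock Definition pdtau (F : fieldType) (A : P4 F) : P4 F := d_tau A.
HB.lock Definition pdodd (F : fieldType) (i : 'I_(2 + 2)) (A : P4 F) : P4 F := d_odd i A.
HB.lock Definition psign (F : fieldType) (A : P4 F) : P4 F := parity_sign A.
HB.lock Definition pbr (F : fieldType) (A B : P4 F) : P4 F := pbracket A B.

(** Degree counts, parity projections, the action of H1 and the partial inverses of such operators
    are all diagonal in the monomial basis. One definition lets them be compared coefficientwise. *)
HB.lock Definition pdiag (F : fieldType) (c : Pmon -> F) (A : P4 F) : P4 F :=
  lin_ext (fun k => c k *: mono F k.1.1 k.1.2 k.2) A.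

Local Infix "**" := pprod (at level 40, left associativity).

(** * Parity of the reordering of odd generators *)

Section Inversions.
Implicit Types (S T U : {set 'I_(2 + 2)}) (i : 'I_(2 + 2)).

Lemma inversions0l S : inversions set0 S = 0%N.
Proof. by rewrite /inversions big_set0. Qed.

Lemma disjoints_setUl S T U :
  [disjoint S :|: T & U] = [disjoint S & U] && [disjoint T & U].
Proof. by rewrite -!setI_eq0 setIUl setU_eq0. Qed.

Lemma disjoints_setUr S T U :
  [disjoint S & T :|: U] = [disjoint S & T] && [disjoint S & U].
Proof. by rewrite -!setI_eq0 setIUr setU_eq0. Qed.

Lemma sum_setU S T (f : 'I_(2 + 2) -> nat) : [disjoint S & T] ->
  (\sum_(i in S :|: T) f i = \sum_(i in S) f i + \sum_(i in T) f i)%N.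
Proof. by move=> dST; rewrite -bigU //=; apply: eq_bigl => i; rewrite !inE. Qed.

Lemma inversionsUl S T U : [disjoint S & T] ->
  inversions (S :|: T) U = (inversions S U + inversions T U)%N.
Proof. exact: sum_setU. Qed.

Lemma inversionsUr S T U : [disjoint T & U] ->
  inversions S (T :|: U) = (inversions S T + inversions S U)%N.
Proof.
move=> dTU; rewrite /inversions -big_split /=.
by apply: eq_bigr => i _; rewrite sum_setU.
Qed.

(** By disjointness every pair in S x T is an inversion in exactly one of the two orders. Modulo 2
    this is the supercommutation sign. *)
Lemma inversionsC S T : [disjoint S & T] ->
  (inversions S T + inversions T S = #|S| * #|T|)%N.
Proof.
move=> dST; rewrite /inversions [X in (_ + X)%N]exchange_big -big_split /=.
rewrite -sum1_card big_distrl /=; apply: eq_bigr => i iS.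
rewrite -big_split /= mul1n -sum1_card; apply: eq_bigr => j jT.
have : i != j by apply: contraTneq iS => ->; rewrite (disjointFl dST jT).
by rewrite -val_eqE /= neq_ltn; case: ltngtP.
Qed.

Lemma inversions11 i : inversions [set i] [set i] = 0%N.
Proof. by rewrite /inversions !big_set1 ltnn. Qed.

Lemma inversionsDl i S T : i \in S ->
  inversions S T = (inversions [set i] T + inversions (S :\ i) T)%N.
Proof.
move=> iS; rewrite -{1}(setD1K iS) inversionsUl //.
by rewrite disjoints1 !inE eqxx.
Qed.

Lemma inversionsDr i S T : i \in T ->
  inversions S T = (inversions S [set i] + inversions S (T :\ i))%N.
Proof.
move=> iT; rewrite -{1}(setD1K iT) inversionsUr //.
by rewrite disjoints1 !inE eqxx.
Qed.

Lemma inversions1D i S : inversions [set i] (S :\ i) = inversions [set i] S.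
Proof.
case: (boolP (i \in S)) => iS; first by rewrite [RHS](inversionsDr _ iS) inversions11.
congr inversions; apply/setP => j; rewrite !inE.
by case: eqP => // ->; rewrite (negPf iS).
Qed.

End Inversions.

(** * The associative superalgebra: product, parity and superderivations *)

Section PoissonAlgebra.
Context (F : fieldType).
Implicit Types (A B C X Y : P4 F) (S T : {set 'I_(2 + 2)}) (i j : 'I_(2 + 2)).
Local Notation mono := (@pmon F).

(** A single premise covers 0, sums and multiples, 0 being reached as -m + m. Multilinear identities
    are reduced to monomials one argument at a time. *)
Lemma mono_ind (Q : P4 F -> Prop) :
  (forall c A B, Q A -> Q B -> Q (c *: A + B)) ->
  (forall a b S, Q (mono a b S)) -> forall A, Q A.
Proof.
move=> QD Qm A.
have Q0 : Q 0 by rewrite -(subrr (mono 0 0 set0)) addrC -scaleN1r; apply: QD.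
rewrite [A]monalgE; elim: (enum_fset _) => [|[[a b] S] s IH]; first by rewrite big_nil.
rewrite big_cons; have -> : << A@_(a, b, S) *g (a, b, S) >> = A@_(a, b, S) *: mono a b S.
  rewrite pmon.unlock; apply/malgP => k; rewrite (mcoeffZ _ _ k) [LHS](mcoeffU (a, b, S) _ k).
  by have -> := mcoeffU (a, b, S) (1 : F) k; rewrite mulrnAr mulr1.
exact: (QD _ _ _ (Qm a b S) IH).
Qed.

Lemma eq_lincomb (V : lmodType F) (c : F) (u u' v v' : V) :
  u = u' -> v = v' -> c *: u + v = c *: u' + v'.
Proof. by move=> -> ->. Qed.

Lemma eq_lincombD (V : lmodType F) (c : F) (u u' v v' w w' : V) :
  u = v + w -> u' = v' + w' -> c *: u + u' = c *: v + v' + (c *: w + w').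
Proof. by move=> -> ->; rewrite scalerDr addrACA. Qed.

Lemma eq_signZ (V : lmodType F) (m n : nat) (v : V) :
  odd m = odd n -> (-1) ^+ m *: v = (-1) ^+ n *: v.
Proof. by move=> mn; rewrite -(signr_odd _ m) mn signr_odd. Qed.

Lemma sign_cancel (m n : nat) : odd (m + n) -> (-1) ^+ m + (-1) ^+ n = 0 :> F.
Proof.
rewrite oddD -[in LHS]signr_odd -[X in _ + X]signr_odd.
by case: (odd m); case: (odd n); rewrite //= ?expr0 ?expr1 ?addNr ?subrr.
Qed.

Fact pmulPr c A B B' : A ** (c *: B + B') = c *: (A ** B) + A ** B'.
Proof. rewrite unlock; exact: pmul_linearr. Qed.
Fact pmulPl c A A' B : (c *: A + A') ** B = c *: (A ** B) + A' ** B.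
Proof. rewrite unlock; exact: pmul_linearl. Qed.
Fact pbrPr c A B B' : pbr A (c *: B + B') = c *: pbr A B + pbr A B'.
Proof. rewrite unlock; exact: pbracket_linearr. Qed.
Fact pbrPl c A A' B : pbr (c *: A + A') B = c *: pbr A B + pbr A' B.
Proof. rewrite unlock; exact: pbracket_linearl. Qed.

HB.instance Definition _ A :=
  GRing.isLinear.Build F (P4 F) (P4 F) *:%R (pprod A) (fun c => pmulPr c A).
HB.instance Definition _ A :=
  GRing.isLinear.Build F (P4 F) (P4 F) *:%R (pbr A) (fun c => pbrPr c A).
(** Gives linearity in the left factor a head symbol, so that it too can be a canonical structure;
    [pbrr] does the same for the bracket. *)
Definition pprodr B A := A ** B.
HB.instance Definition _ B :=
  GRing.isLinear.Build F (P4 F) (P4 F) *:%R (pprodr B) (fun c A A' => pmulPl c A A' B).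
Definition pbrr B A := pbr A B.
HB.instance Definition _ B :=
  GRing.isLinear.Build F (P4 F) (P4 F) *:%R (pbrr B) (fun c A A' => pbrPl c A A' B).

Lemma pmul0l B : pprod 0 B = 0. Proof. exact: (linear0 (pprodr B)). Qed.
Lemma pmul0r A : pprod A 0 = 0. Proof. exact: (linear0 (pprod A)). Qed.
Lemma pmulDl A A' B : pprod (A + A') B = pprod A B + pprod A' B.
Proof. exact: (linearD (pprodr B)). Qed.
Lemma pmulDr A B C : pprod A (B + C) = pprod A B + pprod A C.
Proof. exact: (linearD (pprod A)). Qed.
Lemma pmulNl A B : pprod (- A) B = - pprod A B.
Proof. exact: (linearN (pprodr B)). Qed.
Lemma pmulNr A B : pprod A (- B) = - pprod A B.
Proof. exact: (linearN (pprod A)). Qed.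
Lemma pmulZl c A B : pprod (c *: A) B = c *: pprod A B.
Proof. exact: (linearZ_LR (pprodr B)). Qed.
Lemma pmulZr c A B : pprod A (c *: B) = c *: pprod A B.
Proof. exact: (linearZ_LR (pprod A)). Qed.

Lemma pbr0r A : pbr A 0 = 0. Proof. exact: (linear0 (pbr A)). Qed.
Lemma pbrDr A B C : pbr A (B + C) = pbr A B + pbr A C.
Proof. exact: (linearD (pbr A)). Qed.
Lemma pbrNr A B : pbr A (- B) = - pbr A B.
Proof. exact: (linearN (pbr A)). Qed.
Lemma pbrZl c A B : pbr (c *: A) B = c *: pbr A B.
Proof. exact: (linearZ_LR (pbrr B)). Qed.
Lemma pbrZr c A B : pbr A (c *: B) = c *: pbr A B.
Proof. exact: (linearZ_LR (pbr A)). Qed.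

Fact d_tP c A B : pdt (c *: A + B) = c *: pdt A + pdt B.
Proof. rewrite unlock; exact: lin_ext_linear. Qed.
HB.instance Definition _ := GRing.isLinear.Build F (P4 F) (P4 F) *:%R (@pdt F) (d_tP).
Fact d_t0 : pdt 0 = 0 :> P4 F.
Proof. exact: (linear0 (@pdt F)). Qed.
Fact d_tZ c A : pdt (c *: A) = c *: pdt A.
Proof. exact: (linearZ_LR (@pdt F)). Qed.
Fact d_tauP c A B : pdtau (c *: A + B) = c *: pdtau A + pdtau B.
Proof. rewrite unlock; exact: lin_ext_linear. Qed.
HB.instance Definition _ := GRing.isLinear.Build F (P4 F) (P4 F) *:%R (@pdtau F) (d_tauP).
Fact d_tau0 : pdtau 0 = 0 :> P4 F.
Proof. exact: (linear0 (@pdtau F)). Qed.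
Fact d_tauZ c A : pdtau (c *: A) = c *: pdtau A.
Proof. exact: (linearZ_LR (@pdtau F)). Qed.
Fact d_oddP i c A B : pdodd i (c *: A + B) = c *: pdodd i A + pdodd i B.
Proof. rewrite unlock; exact: lin_ext_linear. Qed.
HB.instance Definition _ i := GRing.isLinear.Build F (P4 F) (P4 F) *:%R (@pdodd F i) (d_oddP i).
Fact d_odd0 i : pdodd i 0 = 0 :> P4 F.
Proof. exact: (linear0 (@pdodd F i)). Qed.
Fact d_oddZ i c A : pdodd i (c *: A) = c *: pdodd i A.
Proof. exact: (linearZ_LR (@pdodd F i)). Qed.
Fact parityP c A B : psign (c *: A + B) = c *: psign A + psign B.
Proof. rewrite unlock; exact: lin_ext_linear. Qed.
HB.instance Definition _ := GRing.isLinear.Build F (P4 F) (P4 F) *:%R (@psign F) (parityP).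
Fact parity0 : psign 0 = 0 :> P4 F.
Proof. exact: (linear0 (@psign F)). Qed.
Fact parityZ c A : psign (c *: A) = c *: psign A.
Proof. exact: (linearZ_LR (@psign F)). Qed.
Fact parityD A B : psign (A + B) = psign A + psign B.
Proof. exact: (linearD (@psign F)). Qed.
Fact parityN A : psign (- A) = - psign A.
Proof. exact: (linearN (@psign F)). Qed.

Definition op0 := (d_t0, d_tau0, d_odd0, parity0).
Definition opZ := (d_tZ, d_tauZ, d_oddZ, parityZ).
Definition opP := (d_tP, d_tauP, d_oddP, parityP).

Lemma pmul_mono a b S c d T : mono a b S ** mono c d T =
  if [disjoint S & T] then
    (-1) ^+ inversions S T *: mono (a + c) (b + d) (S :|: T) else 0.
Proof. by rewrite pprod.unlock pmon.unlock /pmul !lin_ext_mono. Qed.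

Lemma d_t_mono a b S : pdt (mono a b S) = a%:~R *: mono (a - 1) b S.
Proof. by rewrite pdt.unlock pmon.unlock /d_t lin_ext_mono. Qed.

Lemma d_tau_mono a b S : pdtau (mono a b S) = b%:R *: mono a b.-1 S.
Proof. by rewrite pdtau.unlock pmon.unlock /d_tau lin_ext_mono. Qed.

Lemma d_odd_mono i a b S : pdodd i (mono a b S) =
  if i \in S then (-1) ^+ inversions [set i] S *: mono a b (S :\ i) else 0.
Proof. by rewrite pdodd.unlock pmon.unlock /d_odd lin_ext_mono. Qed.

Lemma parity_mono a b S : psign (mono a b S) = (-1) ^+ #|S| *: mono a b S.
Proof. by rewrite psign.unlock pmon.unlock /parity_sign lin_ext_mono signr_odd. Qed.

Lemma pmulA A B C : A ** (B ** C) = A ** B ** C.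
Proof.
elim/mono_ind: A => [x A A' IH IH'|a b S]; first by rewrite !pmulPl; exact: eq_lincomb IH IH'.
elim/mono_ind: B => [x B B'|c d T].
  by move: (mono a b S) => M IH IH'; rewrite pmulPl !pmulPr pmulPl; exact: eq_lincomb IH IH'.
elim/mono_ind: C => [x C C'|e f U].
  by move: (mono a b S) (mono c d T) => M N IH IH'; rewrite !pmulPr; exact: eq_lincomb IH IH'.
rewrite !pmul_mono; case: (boolP [disjoint T & U]) => dTU;
  case: (boolP [disjoint S & T]) => dST /=;
  rewrite ?pmul0r ?pmul0l ?pmulZr ?pmulZl ?pmul_mono.
- rewrite disjoints_setUl disjoints_setUr dST dTU andbT /=.
  case: (boolP [disjoint S & U]) => dSU /=; last by rewrite !scaler0.
  rewrite !scalerA -!exprD !addrA !addnA setUA (inversionsUl _ dST) (inversionsUr _ dTU).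
  by apply: eq_signZ; lia.
- by rewrite disjoints_setUr (negPf dST) scaler0.
- by rewrite disjoints_setUl (negPf dTU) andbF scaler0.
- by [].
Qed.

(** With [psign] for [sigma], this is the Koszul sign acquired when something of parity p moves past
    A. *)
Definition hparity (p : bool) (sigma : P4 F -> P4 F) A := if p then sigma A else A.

Lemma parity_pmul A B : psign (A ** B) = psign A ** psign B.
Proof.
elim/mono_ind: A => [x A A' IH IH'|a b S].
  by rewrite pmulPl !opP pmulPl; exact: eq_lincomb IH IH'.
elim/mono_ind: B => [x B B'|c d T].
  by move: (mono a b S) => M IH IH'; rewrite !(pmulPr, opP) /=; exact: eq_lincomb IH IH'.
rewrite !parity_mono pmulZr pmulZl !pmul_mono.
case: (boolP [disjoint S & T]) => dST /=; last first.
  by rewrite !scaler0 op0.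
rewrite opZ parity_mono !scalerA cardsU (disjoint_setI0 dST) cards0 subn0.
by rewrite -!exprD; apply: eq_signZ; rewrite addnC (addnC #|S|).
Qed.

Lemma parityK : involutive (@psign F).
Proof.
move=> A; elim/mono_ind: A => [x A A' IH IH'|a b S].
  by rewrite !opP; exact: eq_lincomb IH IH'.
by rewrite parity_mono opZ parity_mono scalerA -signr_odd -expr2 sqrr_sign scale1r.
Qed.

Lemma d_t_tau A : pdt (pdtau A) = pdtau (pdt A).
Proof.
elim/mono_ind: A => [x A A' IH IH'|a b S]; first by rewrite !opP; exact: eq_lincomb IH IH'.
rewrite d_tau_mono d_t_mono !opZ d_t_mono d_tau_mono !scalerA.
by rewrite mulrC.
Qed.

Lemma d_t_odd i A : pdt (pdodd i A) = pdodd i (pdt A).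
Proof.
elim/mono_ind: A => [x A A' IH IH'|a b S]; first by rewrite !opP; exact: eq_lincomb IH IH'.
rewrite d_odd_mono d_t_mono !opZ d_odd_mono; case: (boolP (i \in S)) => _ /=; last first.
  by rewrite op0 scaler0.
by rewrite opZ d_t_mono !scalerA mulrC.
Qed.

Lemma d_tau_odd i A : pdtau (pdodd i A) = pdodd i (pdtau A).
Proof.
elim/mono_ind: A => [x A A' IH IH'|a b S]; first by rewrite !opP; exact: eq_lincomb IH IH'.
rewrite d_odd_mono d_tau_mono !opZ d_odd_mono; case: (boolP (i \in S)) => _ /=; last first.
  by rewrite op0 scaler0.
by rewrite opZ d_tau_mono !scalerA mulrC.
Qed.

Lemma parity_d_t A : psign (pdt A) = pdt (psign A).
Proof.
elim/mono_ind: A => [x A A' IH IH'|a b S]; first by rewrite !opP; exact: eq_lincomb IH IH'.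
by rewrite parity_mono d_t_mono !opZ parity_mono d_t_mono !scalerA mulrC.
Qed.

Lemma parity_d_tau A : psign (pdtau A) = pdtau (psign A).
Proof.
elim/mono_ind: A => [x A A' IH IH'|a b S]; first by rewrite !opP; exact: eq_lincomb IH IH'.
by rewrite parity_mono d_tau_mono !opZ parity_mono d_tau_mono !scalerA mulrC.
Qed.

Lemma parity_d_odd i A : psign (pdodd i A) = - pdodd i (psign A).
Proof.
elim/mono_ind: A => [x A A' IH IH'|a b S].
  by rewrite !opP opprD -scalerN; exact: eq_lincomb IH IH'.
rewrite parity_mono opZ d_odd_mono; case: (boolP (i \in S)) => iS /=; last first.
  by rewrite op0 scaler0 oppr0.
rewrite opZ parity_mono !scalerA (cardsD1 i S) iS add1n exprS.
by rewrite mulN1r mulNr scaleNr opprK mulrC.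
Qed.

Definition superder (p : bool) (D : P4 F -> P4 F) :=
  forall A B, D (A ** B) = D A ** B + hparity p (@psign F) A ** D B.

Lemma superder_d_t : superder false (@pdt F).
Proof.
move=> A B; elim/mono_ind: A => [x A A' IH IH'|a b S].
  by rewrite /hparity !(pmulPl, opP) /=; exact: eq_lincombD IH IH'.
elim/mono_ind: B => [x B B'|c d T].
  by move: (mono a b S) => M IH IH'; rewrite !(pmulPr, opP) /=; exact: eq_lincombD IH IH'.
rewrite /hparity !d_t_mono pmulZl pmulZr !pmul_mono.
case: (boolP [disjoint S & T]) => dST /=; last first.
  by rewrite op0 !scaler0 addr0.
rewrite opZ d_t_mono !scalerA intrD mulrDr scalerDl [a - 1 + c]addrAC [a + (c - 1)]addrA.
by move: ((-1) ^+ _) => s; rewrite !(mulrC s).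
Qed.

Lemma superder_d_tau : superder false (@pdtau F).
Proof.
move=> A B; elim/mono_ind: A => [x A A' IH IH'|a b S].
  by rewrite /hparity !(pmulPl, opP) /=; exact: eq_lincombD IH IH'.
elim/mono_ind: B => [x B B'|c d T].
  by move: (mono a b S) => M IH IH'; rewrite !(pmulPr, opP) /=; exact: eq_lincombD IH IH'.
rewrite /hparity !d_tau_mono pmulZl pmulZr !pmul_mono.
case: (boolP [disjoint S & T]) => dST /=; last first.
  by rewrite op0 !scaler0 addr0.
rewrite opZ d_tau_mono !scalerA natrD mulrDr scalerDl.
move: ((-1) ^+ _) => s; rewrite !(mulrC s).
(* The predecessor is truncated at exponent 0, but there its coefficient vanishes. *)
case: b => [|b]; first by rewrite !mul0r !scale0r !add0r add0n.
case: d => [|d]; first by rewrite !mul0r !scale0r !addr0 !addn0.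
have [-> ->] : (b.+1 + d.+1).-1 = (b.+1.-1 + d.+1)%N /\
  (b.+1 + d.+1.-1 = b.+1.-1 + d.+1)%N by split; lia.
by [].
Qed.

(** If i lies in both S and T, the product vanishes and the two terms on the right cancel. Otherwise
    at most one of them survives, and the signs agree modulo 2. *)
Lemma superder_d_odd i : superder true (@pdodd F i).
Proof.
move=> A B; elim/mono_ind: A => [x A A' IH IH'|a b S].
  by rewrite /hparity !(pmulPl, opP) /=; exact: eq_lincombD IH IH'.
elim/mono_ind: B => [x B B'|c d T].
  by move: (mono a b S) => M IH IH'; rewrite !(pmulPr, opP) /=; exact: eq_lincombD IH IH'.
rewrite /hparity parity_mono pmulZl !d_odd_mono pmul_mono.
case: (boolP (i \in S)) => iS; case: (boolP (i \in T)) => iT.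
- have -> : [disjoint S & T] = false.
    by apply/negP => /disjoint_setI0/setP/(_ i); rewrite !inE iS iT.
  rewrite pmulZl pmulZr !pmul_mono op0 -![[disjoint _ & T]]setI_eq0 -![[disjoint S & _]]setI_eq0.
  have -> : (S :\ i) :&: T = S :&: (T :\ i).
    by apply/setP => j; rewrite !inE; case: eqP; rewrite ?andbF.
  case: (boolP (S :&: (T :\ i) == set0)) => d0 /=; last by rewrite !scaler0 addr0.
  have -> : S :\ i :|: T = S :|: T :\ i.
    by apply/setP => j; rewrite !inE; case: eqP => // ->; rewrite iS iT.
  rewrite !scalerA -scalerDl -!exprD.
  rewrite (inversionsDr (S :\ i) iT) (inversionsDl _ iS) inversions1D.
  have := @inversionsC [set i] (S :\ i); rewrite disjoints1 !inE eqxx => /(_ isT).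
  rewrite (cardsD1 i S) iS cards1 mul1n inversions1D => <-.
  rewrite sign_cancel; first by rewrite scale0r.
  by rewrite !oddD /=; do 4!case: (odd (inversions _ _)).
- rewrite pmul0r scaler0 addr0 pmulZl pmul_mono.
  have -> : [disjoint S :\ i & T] = [disjoint S & T].
    rewrite -!setI_eq0; congr (_ == _); apply/setP => j; rewrite !inE.
    by case: eqP => // ->; rewrite (negPf iT) !andbF.
  case: (boolP [disjoint S & T]) => dST /=; last by rewrite op0 scaler0.
  rewrite opZ d_odd_mono inE iS /= !scalerA -!exprD.
  have -> : (S :|: T) :\ i = S :\ i :|: T.
    by apply/setP => j; rewrite !inE; case: eqP => // ->; rewrite (negPf iT).
  apply: eq_signZ; rewrite (inversionsUr _ dST) (inversionsDl _ iS).
  by rewrite !oddD; do 3!case: (odd (inversions _ _)).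
- rewrite pmul0l add0r pmulZr pmul_mono.
  have -> : [disjoint S & T :\ i] = [disjoint S & T].
    rewrite -!setI_eq0; congr (_ == _); apply/setP => j; rewrite !inE.
    by case: eqP => // ->; rewrite (negPf iS).
  case: (boolP [disjoint S & T]) => dST /=; last by rewrite op0 !scaler0.
  rewrite opZ d_odd_mono inE iT orbT /= !scalerA -!exprD.
  have -> : (S :|: T) :\ i = S :|: T :\ i.
    by apply/setP => j; rewrite !inE; case: eqP => // ->; rewrite (negPf iS).
  apply: eq_signZ; rewrite (inversionsUr _ dST) (inversionsDr S iT).
  have := @inversionsC [set i] S; rewrite disjoints1 iS cards1 mul1n => /(_ isT) <-.
  by rewrite !oddD; do 4!case: (odd (inversions _ _)).
- rewrite pmul0l add0r pmul0r scaler0.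
  case: (boolP [disjoint S & T]) => dST /=; last by rewrite op0.
  by rewrite opZ d_odd_mono inE (negPf iS) (negPf iT) scaler0.
Qed.

Lemma mcoeff_mono a b S k : (mono a b S)@_k = ((a, b, S) == k)%:R.
Proof. by rewrite pmon.unlock; exact: (mcoeffU (a, b, S) (1 : F) k). Qed.

Lemma mcoeffP x A B k : (x *: A + B)@_k = x * A@_k + B@_k.
Proof. by rewrite (mcoeffD k) (mcoeffZ x A k). Qed.

Lemma pdiagP (c : Pmon -> F) x A B :
  pdiag c (x *: A + B) = x *: pdiag c A + pdiag c B.
Proof. rewrite pdiag.unlock; exact: lin_ext_linear. Qed.
HB.instance Definition _ c :=
  GRing.isLinear.Build F (P4 F) (P4 F) *:%R (@pdiag F c) (pdiagP c).
Fact pdiag0 c : pdiag c 0 = 0 :> P4 F. Proof. exact: (linear0 (@pdiag F c)). Qed.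
Fact pdiagZ c x A : pdiag c (x *: A) = x *: pdiag c A.
Proof. exact: (linearZ_LR (@pdiag F c)). Qed.

Lemma pdiag_mono (c : Pmon -> F) a b S :
  pdiag c (mono a b S) = c (a, b, S) *: mono a b S.
Proof. by rewrite pdiag.unlock pmon.unlock lin_ext_mono. Qed.

Lemma mcoeff_pdiag (c : Pmon -> F) A k : (pdiag c A)@_k = c k * A@_k.
Proof.
elim/mono_ind: A => [x A B IH IH'|a b S].
  rewrite pdiagP (mcoeffP x (pdiag c A)) (mcoeffP x A) IH IH' mulrDr.
  by rewrite mulrCA.
rewrite pdiag_mono (mcoeffZ _ _ k) mcoeff_mono.
by case: eqP => [->|_]; rewrite ?mulr0.
Qed.

Lemma homogP_psign p A : homogP p A -> psign A = (-1) ^+ p *: A.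
Proof.
move=> hA; have -> : psign A = pdiag (fun k => (-1) ^+ #|k.2|) A.
  elim/mono_ind: A {hA} => [x A B IH IH'|a b S].
    by rewrite opP pdiagP; exact: eq_lincomb.
  by rewrite parity_mono pdiag_mono.
apply/malgP => k; rewrite mcoeff_pdiag (mcoeffZ _ _ k).
have [->|/eqP nz] := eqVneq (A@_k) 0; first by rewrite !mulr0.
by rewrite -signr_odd (hA k) //; apply/eqP.
Qed.

Definition pproj p A := pdiag (fun k => (odd #|k.2| == p)%:R) A.

Lemma homogP_pproj p A : homogP p (pproj p A).
Proof.
move=> k; rewrite /pproj mcoeff_pdiag.
by have [//|_] := eqVneq (odd #|k.2|) p; rewrite mul0r eqxx.
Qed.

Lemma pprojD p A : pproj p A + pproj (~~ p) A = A.
Proof.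
apply/malgP => k; rewrite (mcoeffD k) !mcoeff_pdiag -mulrDl.
by case: (odd _); case: p; rewrite ?addr0 ?add0r mul1r.
Qed.

Lemma pproj_homogP p q A : homogP p A -> pproj q A = (p == q)%:R *: A.
Proof.
move=> hA; apply/malgP => k; rewrite mcoeff_pdiag (mcoeffZ _ _ k).
have [->|nz] := eqVneq (A@_k) 0; first by rewrite !mulr0.
by rewrite (hA k nz).
Qed.

Lemma pproj_id p A : homogP p A -> pproj p A = A.
Proof. by move/pproj_homogP => ->; rewrite eqxx scale1r. Qed.

Lemma superpmulC p A B : homogP p A -> A ** B = hparity p (@psign F) B ** A.
Proof.
(* Homogeneity does not pass to the pieces of the induction. Replacing A by its projection makes the
   claim linear in an arbitrary A. *)
move/pproj_id => <-; rewrite /pproj; elim/mono_ind: A => [x A A' IH IH'|a b S].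
  by rewrite pdiagP pmulPl pmulPr; exact: eq_lincomb.
elim/mono_ind: B => [x B B'|c d T].
  move: (mono a b S) => M IH IH'; rewrite pmulPr.
  have -> : hparity p (@psign F) (x *: B + B') =
            x *: hparity p (@psign F) B + hparity p (@psign F) B'.
    by rewrite /hparity; case: p {IH IH'}; rewrite ?opP.
  by rewrite pmulPl; exact: eq_lincomb.
have -> : hparity p (@psign F) (mono c d T) = (-1) ^+ (p * #|T|) *: mono c d T.
  rewrite /hparity; case: p; first by rewrite parity_mono mul1n.
  by rewrite mul0n expr0 scale1r.
have -> : pdiag (fun k => (odd #|k.2| == p)%:R) (mono a b S) =
          (odd #|S| == p)%:R *: mono a b S by exact: pdiag_mono.
have [<-|_] := eqVneq (odd #|S|) p; last by rewrite scale0r pmul0l pmul0r.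
rewrite scale1r pmulZl !pmul_mono disjoint_sym.
case: (boolP [disjoint T & S]) => dTS /=; last by rewrite scaler0.
rewrite scalerA -exprD setUC addrC addnC; apply: eq_signZ.
have dST : [disjoint S & T] by rewrite disjoint_sym.
have := inversionsC dST => /(congr1 odd); rewrite !oddD !oddM oddb.
by case: (odd (inversions S T)); case: (odd (inversions T S)); case: (_ && _).
Qed.

(** Since 2 is invertible, the eigenvalues 1 and -1 of [psign] differ. With [homogP_psign] this
    turns homogeneity into an equation that can be checked by rewriting. *)
Lemma homogP_psignE (p : bool) A : psign A = (-1) ^+ p *: A -> (2 : F) != 0 -> homogP p A.
Proof.
move=> + two k nz; have -> : psign A = pdiag (fun k => (-1) ^+ #|k.2|) A.
  elim/mono_ind: A {nz} => [x A B IH IH'|a b S].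
    by rewrite opP pdiagP; exact: eq_lincomb.
  by rewrite parity_mono pdiag_mono.
move/malgP/(_ k); rewrite mcoeff_pdiag (mcoeffZ _ _ k) => /(mulIf nz).
have n11 : (1 : F) <> -1.
  by move/eqP; rewrite -subr_eq0 opprK -(natrD _ 1 1) (negPf two).
rewrite -signr_odd; case: (odd _); case: p; rewrite ?expr0 ?expr1 //.
by move/esym.
Qed.

End PoissonAlgebra.

(* The default [done] head-normalises both sides of an equation, which does not
   terminate in practice in P4. *)
Ltac done ::= first
  [ solve [reflexivity]
  | trivial; hnf; intros; solve
    [ do ![solve [trivial | apply: sym_equal; trivial]
          | discriminate | contradiction | split]
    | match goal with H : ~ _ |- _ => solve [case: H; trivial] end
    | match goal with H : _ |- _ => solve [exact: H] end ] ].

HB.lock Definition gb (F : numFieldType) (alpha : F) (i : gindex) : P4 F := gbasis alpha i.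

Definition gpar (i : gindex) : bool :=
  match i with T1 | T2 | T3 | T4 | D1 | D2 | D3 | D4 => true | _ => false end.

(** Exchanges xi_i and eta_i, so that the odd part of the bracket becomes one sum over all four
    generators. *)
Definition dual (i : 'I_(2 + 2)) : 'I_(2 + 2) :=
  match fintype.split i with inl j => rshift 2 j | inr j => lshift 2 j end.

(** * The bracket as a superderivation, and supercommutators of superderivations *)

Section PoissonBracket.
Context (F : numFieldType).
Implicit Types (A B C X Y Z : P4 F) (S T : {set 'I_(2 + 2)}) (i j : 'I_(2 + 2)).
Local Notation mono := (@pmon F).
Local Notation hpar p A := (hparity p (@psign F) A).

Lemma dual_lshift (j : 'I_2) : dual (lshift 2 j) = rshift 2 j.
Proof. by rewrite /dual (unsplitK (inl j)). Qed.

Lemma dual_rshift (j : 'I_2) : dual (rshift 2 j) = lshift 2 j.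
Proof. by rewrite /dual (unsplitK (inr j)). Qed.

Lemma pbrE A B : pbr A B = pdtau A ** pdt B - pdt A ** pdtau B
  - \sum_j pdodd j (psign A) ** pdodd (dual j) B.
Proof.
have -> : \sum_j pdodd j (psign A) ** pdodd (dual j) B = \sum_(j < 2)
    (pmul (d_xi j (parity_sign A)) (d_eta j B) + pmul (d_eta j (parity_sign A)) (d_xi j B)).
  rewrite big_split_ord [RHS]big_split pprod.unlock psign.unlock pdodd.unlock.
  by apply: (f_equal2 +%R); apply: eq_bigr => j _; rewrite (dual_lshift, dual_rshift).
by rewrite pbr.unlock pprod.unlock pdtau.unlock pdt.unlock.
Qed.

Lemma homogPE p A : psign A = (-1) ^+ nat_of_bool p *: A -> homogP p A.
Proof. by move/homogP_psignE; apply; rewrite pnatr_eq0. Qed.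

Lemma homogP_dt p A : homogP p A -> homogP p (pdt A).
Proof. by move/homogP_psign => hA; apply: homogPE; rewrite parity_d_t hA d_tZ. Qed.

Lemma homogP_dtau p A : homogP p A -> homogP p (pdtau A).
Proof. by move/homogP_psign => hA; apply: homogPE; rewrite parity_d_tau hA d_tauZ. Qed.

Lemma homogP_dodd p i A : homogP p A -> homogP (~~ p) (pdodd i A).
Proof.
move/homogP_psign => hA; apply: homogPE; rewrite parity_d_odd hA d_oddZ.
move: (pdodd i A) => Z; case: p {hA}; first by rewrite expr1 expr0 scaleN1r opprK scale1r.
by rewrite expr0 expr1 scale1r scaleN1r.
Qed.

Lemma homogP_sign p A : homogP p A -> homogP p (psign A).
Proof. by move/homogP_psign => hA; apply: homogPE; rewrite {1}hA parityZ hA. Qed.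

Lemma homogP0 p : homogP p (0 : P4 F).
Proof. by apply: homogPE; rewrite parity0 scaler0. Qed.

Lemma homogPD p c A B : homogP p A -> homogP p B -> homogP p (c *: A + B).
Proof.
move=> /homogP_psign hA /homogP_psign hB; apply: homogPE.
by rewrite parityP hA hB scalerDr !scalerA (mulrC c).
Qed.

Lemma superderB p (D E : P4 F -> P4 F) : superder p D -> superder p E ->
  superder p (fun A => D A - E A).
Proof.
move=> hD hE A B; rewrite hD hE pmulDl pmulNl pmulDr pmulNr.
by rewrite opprD addrACA.
Qed.

Lemma superder_sum (I : finType) p (D : I -> P4 F -> P4 F) :
  (forall k, superder p (D k)) -> superder p (fun A => \sum_k D k A).
Proof.
move=> hD A B.
have -> : (\sum_k D k A) ** B = \sum_k (D k A ** B) by exact: (linear_sum (pprodr B)).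
rewrite (linear_sum (pprod _)) -big_split /=.
by apply: eq_bigr => k _; apply: hD.
Qed.

Lemma superder_mull p e Z (D : P4 F -> P4 F) : homogP p Z -> superder e D ->
  superder (p (+) e) (fun A => Z ** D A).
Proof.
move=> hZ hD A B; rewrite hD pmulDr !pmulA; congr (_ + _ ** _).
rewrite (superpmulC _ hZ); congr (_ ** _); rewrite /hparity.
by case: p {hZ}; case: e {hD} => //=; rewrite parityK.
Qed.

(** By [pbrE], bracketing with X is a combination of derivatives with coefficients on the left, and
    [superder_mull] applies to each term. *)
Lemma superder_pbr p X : homogP p X -> superder p (pbr X).
Proof.
move=> hX A B; rewrite !(pbrE X).
have hs : superder p (fun A => pdtau X ** pdt A - pdt X ** pdtau A
    - \sum_j pdodd j (psign X) ** pdodd (dual j) A).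
  apply: superderB; first apply: superderB.
  - by have := superder_mull (homogP_dtau hX) (@superder_d_t F); rewrite addbF.
  - by have := superder_mull (homogP_dt hX) (@superder_d_tau F); rewrite addbF.
  apply: superder_sum => j.
  have := superder_mull (homogP_dodd (i := j) (homogP_sign hX)) (@superder_d_odd F (dual j)).
  by rewrite addbT negbK.
exact: hs.
Qed.

Lemma psign_pbr A B : psign (pbr A B) = pbr (psign A) (psign B).
Proof.
rewrite !pbrE !(parityD, parityN) !parity_pmul !parity_d_t !parity_d_tau.
congr (_ - _); rewrite (linear_sum (@psign F)); apply: eq_bigr => j _ /=.
by rewrite parity_pmul !parity_d_odd pmulNl pmulNr opprK.
Qed.

Lemma homogP_pbr p q A B : homogP p A -> homogP q B -> homogP (p (+) q) (pbr A B).
Proof.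
move=> /homogP_psign hA /homogP_psign hB; apply: homogPE.
by rewrite psign_pbr hA hB pbrZl pbrZr scalerA -signr_addb; congr (_ *: _).
Qed.

(** The terms in which D and E hit different factors cancel. The two hypotheses on [psign] say that
    D and E shift parity by p and q, which gives these terms their signs. *)
Lemma superder_comm p q (D E : {linear P4 F -> P4 F}) :
  superder p D -> superder q E ->
  (forall A, psign (D A) = (-1) ^+ p *: D (psign A)) ->
  (forall A, psign (E A) = (-1) ^+ q *: E (psign A)) ->
  superder (p (+) q) (fun A => D (E A) - (-1) ^+ (p && q) *: E (D A)).
Proof.
move=> hD hE sD sE A B; set s := (-1) ^+ (p && q).
have ss : s * s = 1 by rewrite -expr2 sqrr_sign.
have hpE : hpar p (E A) = s *: E (hpar p A).
  rewrite /s /hparity; case: p {hD sD ss s} => /=; first by rewrite sE.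
  by rewrite expr0 scale1r.
have hqD : hpar q (D A) = s *: D (hpar q A).
  rewrite /s /hparity; case: q {hE sE ss s hpE} => /=; last by rewrite andbF expr0 scale1r.
  by rewrite sD andbT.
have hh : hpar p (hpar q A) = hpar q (hpar p A).
  by rewrite /hparity; case: p {hD sD ss s hpE hqD}; case: q {hE sE}.
have hpq : hpar (p (+) q) A = hpar p (hpar q A).
  by rewrite /hparity; case: p {hD sD ss s hpE hqD hh}; case: q {hE sE} => //=; rewrite parityK.
have DD x y : D (x + y) = D x + D y by exact: linearD.
have ED x y : E (x + y) = E x + E y by exact: linearD.
have -> : D (E (A ** B)) = D (E A) ** B + s *: (E (hpar p A) ** D B)
    + (D (hpar q A) ** E B + hpar p (hpar q A) ** D (E B)).
  by rewrite hE DD hD hD hpE pmulZl.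
have -> : s *: E (D (A ** B)) = s *: (E (D A) ** B) + D (hpar q A) ** E B
    + (s *: (E (hpar p A) ** D B) + s *: (hpar p (hpar q A) ** E (D B))).
  rewrite hD ED hE hE hqD pmulZl hh scalerDr scalerDr scalerA ss scale1r.
  by rewrite scalerDr.
rewrite hpq pmulDl pmulNl pmulZl pmulDr pmulNr pmulZr.
move: (D (E A) ** B) (s *: (E (D A) ** B)) => a a'.
move: (s *: (E _ ** D B)) (D _ ** E B) => b c.
move: (_ ** D (E B)) (s *: (_ ** E (D B))) => d d'.
rewrite !opprD !addrA.
(* Pairs each mixed term with its opposite: 2 with 7 and 3 with 6. *)
rewrite (AC (8) (1*5*(4*8)*(2*7)*(3*6))) /= !subrr !addr0.
by rewrite addrA.
Qed.

Definition tp a := mono a 0 set0.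
(** Covers all four odd generators, the indices 2 and 3 being eta_1 and eta_2. *)
Definition xi i := mono 0 0 [set i].

Lemma tp_mono a b c S : tp a ** mono b c S = mono (a + b) c S.
Proof.
rewrite /tp pmul_mono -setI_eq0 set0I eqxx.
by rewrite inversions0l expr0 scale1r set0U.
Qed.

Lemma tau_mono b c S : mono 0 1 set0 ** mono b c S = mono b c.+1 S.
Proof.
rewrite pmul_mono -setI_eq0 set0I eqxx.
by rewrite inversions0l expr0 scale1r set0U add0r.
Qed.

Lemma xi_mono i b c S : i \notin S ->
  xi i ** mono b c S = (-1) ^+ inversions [set i] S *: mono b c (i |: S).
Proof. by move=> iS; rewrite /xi pmul_mono disjoints1 iS add0r. Qed.

(** The kernel of a superderivation is closed under products, and t, 1/t, tau and the odd generators
    generate the algebra. *)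
Lemma superder_gen0 p (D : {linear P4 F -> P4 F}) : superder p D ->
  D (tp 1) = 0 -> D (tp (-1)) = 0 -> D (mono 0 1 set0) = 0 ->
  (forall i, D (xi i) = 0) -> forall A, D A = 0.
Proof.
move=> hD Dt DT Dtau Dxi.
have st g A : D g = 0 -> D A = 0 -> D (g ** A) = 0.
  by move=> Dg DA; rewrite hD Dg DA pmul0l pmul0r addr0.
have D1 : D (mono 0 0 set0) = 0.
  by have := st _ _ Dt DT; rewrite tp_mono subrr.
have DS S : D (mono 0 0 S) = 0.
  move: {2}#|S| (leqnn #|S|) => n; elim: n S => [|n IH] S.
    by rewrite leqn0 cards_eq0 => /eqP ->.
  have [->|[i iS]] := set_0Vmem S; first by rewrite D1.
  rewrite (cardsD1 i S) iS add1n ltnS => /IH DSi.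
  have niS : i \notin S :\ i by rewrite !inE eqxx.
  have := st _ _ (Dxi i) DSi; rewrite (xi_mono _ _ niS) (setD1K iS) linearZ_LR.
  by move/eqP; rewrite scaler_eq0 signr_eq0 => /eqP.
have Db b S : D (mono 0 b S) = 0.
  by elim: b => [|b IH]; rewrite ?DS // -tau_mono; apply: st.
have Da a b S : D (mono a b S) = 0.
  elim/int_rec: a => [|n IH|n IH]; first exact: Db.
    by rewrite intS -tp_mono; apply: st.
  by rewrite intS opprD -tp_mono; apply: st.
by move=> A; elim/mono_ind: A => [x A B DA DB|a b S]; rewrite ?linearP /= ?DA ?DB ?scaler0 ?addr0.
Qed.

End PoissonBracket.

(** * The Jacobi identity for two basis elements of Gamma acting on the Poisson algebra *)

Section Gamma.
Import GammaClosed.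
Context (F : numFieldType) (alpha : F).
Local Notation ev := (GammaClosed.ev alpha).
Local Notation mono := (@pmon F).

Lemma pbr_ev r s : pbr (ev r) (ev s) = ev (rbr r s).
Proof. by rewrite pbr.unlock ev_br. Qed.

Lemma gb_ev i : gb alpha i = ev (rgb i).
Proof. by rewrite gb.unlock ev_gb. Qed.

Lemma tp_ev a : tp F a = ev (rt a).
Proof. by rewrite -ev_t /tp pmon.unlock. Qed.

Lemma tau_ev : mono 0 1 set0 = ev rtau.
Proof. by rewrite -ev_tau pmon.unlock. Qed.

Lemma xi_ev i : xi F i = ev (rodd i).
Proof. by rewrite ev1 scale1r /kmono /xi pmon.unlock bset_unit. Qed.

Lemma homogP_ev p r :
  all (fun x => odd (sumn [seq nat_of_bool (nth false x.2.2 i) | i <- iota 0 4]) == p) r ->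
  homogP p (ev r).
Proof.
elim: r => [_|x r IH /= /andP[/eqP px /IH hr]]; first by rewrite ev_nil; apply: homogP0.
rewrite ev_cons; apply: homogPD hr.
apply: homogPE; rewrite /kmono; have := parity_mono F x.2.1.1 x.2.1.2 (bset x.2.2).
by rewrite pmon.unlock => ->; rewrite -signr_odd card_bset px.
Qed.

Lemma homogP_gb i : homogP (gpar i) (gb alpha i).
Proof. by rewrite gb_ev; apply: homogP_ev; case: i; vm_compute. Qed.

Definition gens : seq (seq (int * nat * (int * nat * seq bool))) :=
  [:: rt 1; rt (-1); rtau; rodd 0; rodd 1; rodd 2; rodd 3].

(** In these lists of terms alpha is a formal variable, so one evaluation on the seven algebra
    generators serves every value of alpha. *)
Lemma jacobi_check : all (fun i => all (fun j => all (fun g =>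
  rzero (rbr (rgb i) (rbr (rgb j) g)
         ++ rscale (-1) 0 (rscale (rsign (gpar i && gpar j)) 0 (rbr (rgb j) (rbr (rgb i) g)))
         ++ rscale (-1) 0 (rbr (rbr (rgb i) (rgb j)) g))) gens) gindices) gindices.
Proof. by vm_compute. Qed.

(* Both sides define superderivations in the last argument, which reduces the
   identity to the generators of the algebra. *)
Lemma gb_jacobi i j A :
  pbr (pbr (gb alpha i) (gb alpha j)) A =
  pbr (gb alpha i) (pbr (gb alpha j) A)
  - (-1) ^+ (gpar i && gpar j) *: pbr (gb alpha j) (pbr (gb alpha i) A).
Proof.
have sp k B : psign (pbr (gb alpha k) B) = (-1) ^+ gpar k *: pbr (gb alpha k) (psign B).
  by rewrite psign_pbr (homogP_psign (@homogP_gb k)) pbrZl.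
pose X := gb alpha i; pose Y := gb alpha j; pose s : F := (-1) ^+ (gpar i && gpar j).
pose D : {linear P4 F -> P4 F} :=
  (pbr X \o pbr Y) \- s \*: (pbr Y \o pbr X) \- pbr (pbr X Y).
have sD : superder (gpar i (+) gpar j) D.
  apply: superderB.
    apply: (superder_comm (superder_pbr (@homogP_gb i)) (superder_pbr (@homogP_gb j))).
      exact: sp.
    exact: sp.
  apply: superder_pbr; apply: homogP_pbr; exact: homogP_gb.
have D0 g : g \in gens -> D (ev g) = 0.
  move=> gg; have := jacobi_check.
  move=> /allP/(_ _ (mem_gindices i))/allP/(_ _ (mem_gindices j))/allP/(_ g gg).
  move/(ev_zero alpha); rewrite (ev_cat alpha (rbr (rgb i) _)) (ev_cat alpha (rscale _ _ _)).
  rewrite !ev_scale !mulr1 rsignE rmorphN1 !scaleN1r.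
  have -> : D (ev g) = pbr X (pbr Y (ev g)) - s *: pbr Y (pbr X (ev g)) - pbr (pbr X Y) (ev g).
    by [].
  by rewrite /s /X /Y !gb_ev !pbr_ev addrA.
have Dt : D (tp F 1) = 0 by rewrite tp_ev; exact: (D0 (rt 1) isT).
have DT : D (tp F (-1)) = 0 by rewrite tp_ev; exact: (D0 (rt (-1)) isT).
have Dtau : D (mono 0 1 set0) = 0 by rewrite tau_ev; exact: (D0 rtau isT).
have Dxi k : D (xi F k) = 0.
  by rewrite xi_ev; apply: D0; case: k => [[|[|[|[|//]]]] lk]; exact: isT.
have : pbr X (pbr Y A) - s *: pbr Y (pbr X A) - pbr (pbr X Y) A = 0.
  exact: (superder_gen0 sD Dt DT Dtau Dxi A).
by move/eqP; rewrite subr_eq0 => /eqP <-.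
Qed.

End Gamma.

(** * Euler operators, integration in tau and the Koszul homotopy *)

Section Operators.
Context (F : numFieldType).
Implicit Types (A B : P4 F) (S T : {set 'I_(2 + 2)}) (i j : 'I_(2 + 2)).
Local Notation mono := (@pmon F).
Local Notation tp := (@tp F).
Local Notation tau := (pmon F 0 1 set0).
Local Notation xi := (@xi F).

Lemma tp0_mul A : tp 0 ** A = A.
Proof.
elim/mono_ind: A => [x A B IH IH'|a b S]; first by rewrite pmulPr; exact: eq_lincomb.
by rewrite tp_mono add0r.
Qed.

Lemma tp_mulA a b A : tp a ** (tp b ** A) = tp (a + b) ** A.
Proof. by rewrite pmulA tp_mono. Qed.

Lemma tp_mulK a A : tp a ** (tp (- a) ** A) = A.
Proof. by rewrite tp_mulA subrr tp0_mul. Qed.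

Lemma tp_mul_eq0 a A : tp a ** A = 0 -> A = 0.
Proof. by move=> h; rewrite -[A](tp_mulK (- a)) opprK h pmul0r. Qed.

Lemma d_tau_tp a A : pdtau (tp a ** A) = tp a ** pdtau A.
Proof. by rewrite superder_d_tau d_tau_mono scale0r pmul0l add0r. Qed.

Lemma d_odd_tp j a A : pdodd j (tp a ** A) = tp a ** pdodd j A.
Proof.
rewrite superder_d_odd d_odd_mono in_set0 pmul0l add0r /hparity.
by rewrite parity_mono cards0 expr0 scale1r.
Qed.

Lemma d_tau_xi i A : pdtau (xi i ** A) = xi i ** pdtau A.
Proof. by rewrite superder_d_tau d_tau_mono scale0r pmul0l add0r. Qed.

Lemma d_odd_xi i j A :
  pdodd i (xi j ** A) = (i == j)%:R *: A - xi j ** pdodd i A.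
Proof.
rewrite superder_d_odd /hparity parity_mono cards1 expr1 scaleN1r pmulNl.
rewrite d_odd_mono in_set1; congr (_ - _).
case: eqP => [->|_]; last by rewrite pmul0l scale0r.
by rewrite inversions11 expr0 scale1r setDv scale1r tp0_mul.
Qed.

Lemma tau_d_tau A : tau ** pdtau A = pdiag (fun k => k.1.2%:R) A.
Proof.
elim/mono_ind: A => [x A B IH IH'|a b S].
  by rewrite d_tauP pmulPr pdiagP; exact: eq_lincomb.
rewrite d_tau_mono pmulZr tau_mono pdiag_mono /=.
by case: b => [|b]; rewrite ?scale0r.
Qed.

Lemma t_d_t A : tp 1 ** pdt A = pdiag (fun k => k.1.1%:~R) A.
Proof.
elim/mono_ind: A => [x A B IH IH'|a b S].
  by rewrite d_tP pmulPr pdiagP; exact: eq_lincomb.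
by rewrite d_t_mono pmulZr tp_mono pdiag_mono addrC subrK.
Qed.

(** Each summand fixes the monomials that contain the j-th generator, its sign occurring twice, and
    kills the others. *)
Lemma euler A : \sum_j xi j ** pdodd j A = pdiag (fun k => #|k.2|%:R) A.
Proof.
elim/mono_ind: A => [x A B IH IH'|a b S].
  rewrite pdiagP -IH -IH' scaler_sumr -big_split /=.
  by apply: eq_bigr => j _; rewrite d_oddP pmulPr.
rewrite pdiag_mono /=.
have -> : \sum_j xi j ** pdodd j (mono a b S) = \sum_j (j \in S)%:R *: mono a b S.
  apply: eq_bigr => j _; rewrite d_odd_mono.
  case: (boolP (j \in S)) => jS /=; last by rewrite pmul0r scale0r.
  have nj : j \notin S :\ j by rewrite !inE eqxx.
  by rewrite pmulZr (xi_mono F a b nj) (setD1K jS) inversions1D scalerA -expr2 sqrr_sign.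
have -> : #|S|%:R = \sum_j (j \in S)%:R :> F.
  by rewrite -natr_sum -sum1_card big_mkcond.
by rewrite scaler_suml.
Qed.

(** An odd derivative lowers the number of odd factors by one, hence the shift on the right. *)
Lemma d_odd_pdiag (c : nat -> F) i A :
  pdodd i (pdiag (fun k => c #|k.2|) A) = pdiag (fun k => c #|k.2|.+1) (pdodd i A).
Proof.
elim/mono_ind: A => [x A B IH IH'|a b S].
  by rewrite pdiagP !d_oddP pdiagP; exact: eq_lincomb.
rewrite pdiag_mono d_oddZ !d_odd_mono /=.
case: (boolP (i \in S)) => iS /=; last by rewrite scaler0 pdiag0.
rewrite pdiagZ pdiag_mono /= !scalerA mulrC.
by rewrite (cardsD1 i S) iS.
Qed.

Lemma d_odd_pdiag_tt (c : int -> nat -> F) i A :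
  pdodd i (pdiag (fun k => c k.1.1 k.1.2) A) = pdiag (fun k => c k.1.1 k.1.2) (pdodd i A).
Proof.
elim/mono_ind: A => [x A B IH IH'|a b S].
  by rewrite pdiagP !d_oddP pdiagP; exact: eq_lincomb.
rewrite pdiag_mono d_oddZ !d_odd_mono /=.
case: (boolP (i \in S)) => iS /=; last by rewrite scaler0 pdiag0.
by rewrite pdiagZ pdiag_mono /= !scalerA mulrC.
Qed.

Lemma d_tau_pdiag (c : Pmon -> F) A :
  pdtau (pdiag c A) = pdiag (fun k => c (k.1.1, k.1.2.+1, k.2)) (pdtau A).
Proof.
elim/mono_ind: A => [x A B IH IH'|a b S].
  by rewrite pdiagP !d_tauP pdiagP; exact: eq_lincomb.
rewrite pdiag_mono d_tauZ !d_tau_mono pdiagZ pdiag_mono /= !scalerA.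
case: b => [|b]; last by rewrite mulrC.
by rewrite mulr0 mul0r !scale0r.
Qed.

(* On ker d_tau these are the elements killed by E1, T1, ..., T4. *)
Definition Tinvariant A := pdtau A = 0 /\ forall j, pdodd j A = 0.

(** The operators tau d_tau and Euler's operator kill A and are diagonal with eigenvalues the
    tau-degree and the number of odd factors. Hence invariants are Laurent polynomials in t. *)
Lemma invariant_coeff A k : Tinvariant A -> A@_k != 0 -> k.1.2 = 0%N /\ k.2 = set0.
Proof.
move=> [tA oA] nz; split.
  have /(congr1 (mcoeff k)) := tau_d_tau A; rewrite tA pmul0r mcoeff_pdiag mcoeff0.
  by move/esym/eqP; rewrite mulf_eq0 (negPf nz) orbF pnatr_eq0 => /eqP.
have /(congr1 (mcoeff k)) := euler A; rewrite mcoeff_pdiag big1; last first.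
  by move=> j _; rewrite oA pmul0r.
rewrite mcoeff0.
by move/esym/eqP; rewrite mulf_eq0 (negPf nz) orbF pnatr_eq0 cards_eq0 => /eqP.
Qed.

Definition tau_int A := lin_ext (fun k => k.1.2.+1%:R^-1 *: mono k.1.1 k.1.2.+1 k.2) A.

Lemma tau_int_mono a b S : tau_int (mono a b S) = b.+1%:R^-1 *: mono a b.+1 S.
Proof. by rewrite /tau_int pmon.unlock lin_ext_mono. Qed.

Lemma d_tau_int A : pdtau (tau_int A) = A.
Proof.
elim/mono_ind: A => [x A B IH IH'|a b S].
  rewrite /tau_int lin_ext_linear d_tauP; exact: eq_lincomb.
rewrite tau_int_mono d_tauZ d_tau_mono scalerA mulVf; last by rewrite pnatr_eq0.
exact: scale1r.
Qed.

(* By Euler's identity the odd derivatives of [\sum_j xi j ** w j] are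
   [(1 + N) (w i)], N being the number operator. *)
Lemma koszul (w : 'I_(2 + 2) -> P4 F) :
  (forall i, pdtau (w i) = 0) ->
  (forall i j, pdodd i (w j) = - pdodd j (w i)) ->
  exists v, pdtau v = 0 /\ forall i, pdodd i v = w i.
Proof.
move=> tw ww; pose V := \sum_j xi j ** w j.
have tV : pdtau V = 0.
  rewrite /V (linear_sum (@pdtau F)) big1 // => j _.
  by rewrite /= d_tau_xi tw pmul0r.
have oV i : pdodd i V = w i + pdiag (fun k => #|k.2|%:R) (w i).
  rewrite /V (linear_sum (@pdodd F i)) -euler /=.
  have -> : \sum_j pdodd i (xi j ** w j) =
      \sum_j ((i == j)%:R *: w j + xi j ** pdodd j (w i)).
    by apply: eq_bigr => j _; rewrite d_odd_xi ww pmulNr opprK.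
  rewrite big_split /=; apply: (f_equal2 +%R); last by [].
  rewrite (bigD1 i) // eqxx scale1r big1 => [|j ji]; first exact: addr0.
  by rewrite eq_sym (negPf ji) scale0r.
(* Moved past an odd derivative, 1/N becomes 1/(N + 1), which never divides by 0. *)
exists (pdiag (fun k => #|k.2|%:R^-1) V); split.
  by rewrite d_tau_pdiag tV pdiag0.
move=> i; rewrite (d_odd_pdiag (fun n => n%:R^-1)) oV.
apply/malgP => k; rewrite mcoeff_pdiag (mcoeffD k) mcoeff_pdiag.
rewrite -[X in _ * (X + _)]mul1r -mulrDl mulrA -natr1 addrC mulVf ?mul1r //.
by rewrite addrC natr1 pnatr_eq0.
Qed.

End Operators.

(** Indexed so that [Tof j] acts on ker d_tau as t times the j-th odd derivative; it is thus t times
    the dual of the j-th generator. In [Dof j] the leading term is tau times the j-th generator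
    itself. *)
Definition Tof (j : 'I_(2 + 2)) : gindex := nth T1 [:: T1; T2; T3; T4] j.
Definition Dof (j : 'I_(2 + 2)) : gindex := nth D1 [:: D1; D2; D3; D4] j.

(** * Brackets of basis elements, cocycles on the basis, and the action of each element *)

Section Relations.
Import GammaClosed.
Local Notation comb := (seq (int * nat * gindex)).

(* Unlike gindex_code, which goes through inord, this reduces under vm_compute. *)
Definition gnum (i : gindex) : nat :=
  match i with
  | E1 => 0 | F1 => 1 | H1 => 2 | E2 => 3 | F2 => 4 | H2 => 5
  | E3 => 6 | F3 => 7 | H3 => 8 | T1 => 9 | T2 => 10 | T3 => 11
  | T4 => 12 | D1 => 13 | D2 => 14 | D3 => 15 | D4 => 16
  end.

Lemma gnum_inj : injective gnum. Proof. by case; case. Qed.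

(* [2 [X_i, X_j] = \sum_(x <- s) x.1.1 alpha^x.1.2 X_(x.2)]; the factor 2 keeps
   the coefficients of H2 and H3 integral. *)
Definition bracket_is (i j : gindex) (s : comb) : bool :=
  rzero (rscale 2 0 (rbr (rgb i) (rgb j))
         ++ rscale (-1) 0 (flatten [seq rscale x.1.1 x.1.2 (rgb x.2) | x <- s])).

(** Twice the contribution of a term on the leading monomial of k. The leading monomials of H2 and
    H3 are xi_1 eta_1 = (H2 + H3)/2 and xi_2 eta_2 = (H2 - H3)/2. *)
Definition lead_lift (k : gindex) (x : int * nat * (int * nat * seq bool)) : comb :=
  match k with
  | H2 => [:: (x.1, H2); (x.1, H3)]
  | H3 => [:: (x.1, H2); (- x.1.1, x.1.2, H3)]
  | _ => [:: (2 * x.1.1, x.1.2, k)]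
  end.

(** Reads candidate coefficients off the leading monomials; [bracket_in] verifies the candidate
    through [bracket_is]. *)
Definition bracket_comb (good : seq gindex) (i j : gindex) : comb :=
  flatten [seq flatten [seq lead_lift k x | x <- rbr (rgb i) (rgb j) & x.2 == lead k]
             | k <- good].

Definition bracket_in (good : seq gindex) (i j : gindex) : bool :=
  bracket_is i j (bracket_comb good i j) &&
  all (fun x => gnum x.2 \in map gnum good) (bracket_comb good i j).

Context (F : numFieldType) (alpha : F).
Implicit Types (A B v : P4 F).
Local Notation mono := (@pmon F).
Local Notation tp := (@tp F).
Local Notation tau := (pmon F 0 1 set0).
Local Notation xi := (@xi F).
Local Notation X := (gb alpha).
Local Notation ev := (GammaClosed.ev alpha).

Definition coef (x : int * nat * gindex) : F := x.1.1%:~R * alpha ^+ x.1.2.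

Lemma ev_eq r s : rzero (r ++ rscale (-1) 0 s) -> ev r = ev s.
Proof.
move/(ev_zero alpha); rewrite ev_cat ev_scale mulr1 rmorphN1 scaleN1r.
by move/eqP; rewrite subr_eq0 => /eqP.
Qed.

Lemma ev0 r : rzero r -> ev r = 0. Proof. exact: ev_zero. Qed.

Lemma bracket_isE i j s : bracket_is i j s ->
  2 *: pbr (X i) (X j) = \sum_(x <- s) coef x *: X x.2.
Proof.
move/ev_eq; rewrite ev_scale mulr1 -pbr_ev -!gb_ev => ->.
elim: s => [|x s IH]; first by rewrite /= ev_nil big_nil.
by rewrite big_cons /= ev_cat ev_scale IH gb_ev.
Qed.

(* For an odd cocycle c, the map X |-> (-1)^p(X) c X satisfies the identity of an
   even one, so that both parities are covered; U i is the value at X_i. *)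
Definition lcocycle (U : gindex -> P4 F) :=
  forall i j s, bracket_is i j s ->
    2 *: (pbr (X i) (U j) - (-1) ^+ (gpar i && gpar j) *: pbr (X j) (U i))
    = \sum_(x <- s) coef x *: U x.2.

(** From the Jacobi identity [gb_jacobi], for v not necessarily homogeneous. *)
Lemma lcocycle_cob v : lcocycle (fun i => pbr (X i) v).
Proof.
move=> i j s ij; rewrite -gb_jacobi -pbrZl (bracket_isE ij).
rewrite -[LHS]/(pbrr v _) (linear_sum (pbrr v)); apply: eq_bigr => x _.
exact: pbrZl.
Qed.

Lemma sub_shuffle (V : lmodType F) (x y z w : V) (s c : F) :
  2 *: (x - c *: y - s *: (z - c *: w)) =
  2 *: (x - s *: z) - c *: (2 *: (y - s *: w)).
Proof.
rewrite [c *: (2 *: _)]scalerA (mulrC c) -scalerA -scalerBr; congr (_ *: _).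
rewrite !scalerBr !scalerA (mulrC c).
move: (c *: y) (s *: z) ((s * c) *: w) => a b d.
by rewrite !opprB addrACA [RHS]addrACA (addrC (- a)).
Qed.

Lemma sum_sub_scale (V : lmodType F) (T : Type) (s : seq T) (a : T -> F) (u v : T -> V) (c : F) :
  \sum_(x <- s) a x *: (u x - c *: v x) =
  \sum_(x <- s) a x *: u x - c *: \sum_(x <- s) a x *: v x.
Proof.
rewrite scaler_sumr -sumrB; apply: eq_bigr => x _.
by rewrite scalerBr !scalerA (mulrC c).
Qed.

Lemma lcocycle_sub U V c : lcocycle U -> lcocycle V -> lcocycle (fun i => U i - c *: V i).
Proof.
move=> hU hV i j s ij.
apply: (etrans _ (esym (sum_sub_scale s coef (fun x => U x.2) (fun x => V x.2) c))).
apply: (etrans _ (f_equal2 (fun a b => a - c *: b) (hU i j s ij) (hV i j s ij))).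
rewrite !pbrDr !pbrNr !pbrZr.
exact: sub_shuffle.
Qed.

(** Where U vanishes on a span containing [X_i, X_j], the cocycle identity becomes a symmetry
    between the two remaining terms. The reduction mostly proceeds through this form. *)
Lemma lcocycle_in U good i j : lcocycle U -> bracket_in good i j ->
  (forall k, k \in good -> U k = 0) ->
  pbr (X i) (U j) = (-1) ^+ (gpar i && gpar j) *: pbr (X j) (U i).
Proof.
move=> hU /andP[ij /allP sub] U0.
have := hU i j _ ij; rewrite big_seq big1 => [|x xs]; last first.
  by rewrite (U0 x.2); [exact: scaler0|have := sub x xs; rewrite (mem_map gnum_inj)].
move/eqP; rewrite scaler_eq0 pnatr_eq0 /= subr_eq0 => /eqP.
by [].
Qed.

(** The coefficients coming from the basis element are computed on lists of terms while A stays
    abstract. *)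
Lemma pbr_ev_l r A : pbr (ev r) A = ev (rdtau r) ** pdt A - ev (rdt r) ** pdtau A
  - \sum_(j : 'I_(2 + 2)) ev (rdodd j (rpar r)) ** pdodd (dual j) A.
Proof.
rewrite pbrE; have -> : pdtau (ev r) = ev (rdtau r) by rewrite pdtau.unlock ev_dtau.
have -> : pdt (ev r) = ev (rdt r) by rewrite pdt.unlock ev_dt.
congr (_ - _); apply: eq_bigr => j _; congr (_ ** _).
by rewrite -ev_dodd -ev_par psign.unlock pdodd.unlock.
Qed.

Lemma gb_E1 A : pbr (X E1) A = - (2 *: (tp 1 ** pdtau A)).
Proof.
rewrite gb_ev pbr_ev_l big1 => [|j _].
  have -> : ev (rdtau (rgb E1)) = 0 by apply: ev0; vm_compute.
  have -> : ev (rdt (rgb E1)) = 2 *: tp 1.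
    have -> : 2 *: tp 1 = ev (rscale 2 0 (rt 1)) by rewrite ev_scale mulr1 (tp_ev alpha).
    by apply: ev_eq; vm_compute.
  by rewrite pmul0l sub0r subr0 pmulZl.
have -> : ev (rdodd j (rpar (rgb E1))) = 0; last by rewrite pmul0l.
by apply: ev0; case: j => [[|[|[|[|//]]]] lj]; vm_compute.
Qed.

Lemma gb_H1 A : pbr (X H1) A = pdiag (fun k => k.1.1%:~R - k.1.2%:R) A.
Proof.
rewrite gb_ev pbr_ev_l big1 => [|j _].
  have -> : ev (rdtau (rgb H1)) = tp 1 by rewrite (tp_ev alpha); apply: ev_eq; vm_compute.
  have -> : ev (rdt (rgb H1)) = tau by rewrite (tau_ev alpha); apply: ev_eq; vm_compute.
  rewrite subr0 t_d_t tau_d_tau; apply/malgP => k.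
  by rewrite (mcoeffB k) !mcoeff_pdiag mulrBl.
have -> : ev (rdodd j (rpar (rgb H1))) = 0; last by rewrite pmul0l.
by apply: ev0; case: j => [[|[|[|[|//]]]] lj]; vm_compute.
Qed.

Lemma dual_val j : dual j = nth 0%N [:: 2; 3; 0; 1]%N j :> nat.
Proof.
rewrite /dual; case: splitP => k ->; rewrite /=.
  by case: k => [[|[|//]] lk].
by case: k => [[|[|//]] lk].
Qed.

Lemma dualK : involutive dual.
Proof. by move=> j; apply/val_inj; rewrite /= !dual_val; case: j => [[|[|[|[|//]]]] lj]. Qed.

Lemma gb_Tof j A : pdtau A = 0 -> pbr (X (Tof j)) A = tp 1 ** pdodd j A.
Proof.
move=> tA; rewrite gb_ev pbr_ev_l tA pmul0r.
have -> : ev (rdtau (rgb (Tof j))) = 0.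
  by apply: ev0; case: j => [[|[|[|[|//]]]] lj]; vm_compute.
rewrite pmul0l subr0 sub0r (bigD1 (dual j)) // dualK big1 => [|k kj].
  have -> : ev (rdodd (dual j) (rpar (rgb (Tof j)))) = - tp 1.
    have -> : - tp 1 = ev (rscale (-1) 0 (rt 1)).
      by rewrite ev_scale mulr1 (tp_ev alpha) rmorphN1 scaleN1r.
    apply: ev_eq.
    by rewrite dual_val; case: j {tA} => [[|[|[|[|//]]]] lj]; vm_compute.
  by rewrite pmulNl; apply: (etrans (f_equal -%R (addr0 _))); exact: opprK.
have -> : ev (rdodd k (rpar (rgb (Tof j)))) = 0; last by rewrite pmul0l.
apply: ev0; move: kj; rewrite -val_eqE /= dual_val.
by case: j {tA} => [[|[|[|[|//]]]] lj]; case: k => [[|[|[|[|//]]]] lk]; vm_compute.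
Qed.

(** The two copies of sl(2) that involve neither t nor tau. *)
Definition is_k (i : gindex) : bool :=
  match i with E2 | F2 | H2 | E3 | F3 | H3 => true | _ => false end.

Lemma gb_k i A : is_k i -> Tinvariant A -> pbr (X i) A = 0.
Proof.
move=> ik [tA oA]; rewrite gb_ev pbr_ev_l tA pmul0r subr0 big1 => [|j _]; last first.
  by rewrite oA pmul0r.
have -> : ev (rdtau (rgb i)) = 0; last by rewrite pmul0l subr0.
by apply: ev0; case: i ik => // _; vm_compute.
Qed.

Lemma gb_Dof j A : Tinvariant A -> pbr (X (Dof j)) A = xi j ** pdt A.
Proof.
move=> [tA oA]; rewrite gb_ev pbr_ev_l tA pmul0r subr0 big1 => [|k _]; last first.
  by rewrite oA pmul0r.
rewrite subr0; congr (_ ** _); rewrite (xi_ev alpha); apply: ev_eq.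
by case: j => [[|[|[|[|//]]]] lj]; vm_compute.
Qed.

Lemma E1_eq0 A : pbr (X E1) A = 0 -> pdtau A = 0.
Proof.
rewrite gb_E1 => /eqP; rewrite oppr_eq0 scaler_eq0 pnatr_eq0 /= => /eqP.
exact: tp_mul_eq0.
Qed.

Lemma Tof_eq0 j A : pdtau A = 0 -> pbr (X (Tof j)) A = 0 -> pdodd j A = 0.
Proof. by move=> tA; rewrite gb_Tof //; exact: tp_mul_eq0. Qed.

Lemma cobound_E1 A : exists v, pbr (X E1) v = A.
Proof.
(* Inverts -2 t d_tau factor by factor. *)
exists (- 2^-1 *: (tp (-1) ** tau_int A)).
rewrite gb_E1 d_tauZ d_tau_tp d_tau_int pmulZr tp_mulK scalerA.
by rewrite mulrN divff ?pnatr_eq0 // scaleN1r opprK.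
Qed.

(* 1/0 = 0 makes [v] omit the weight-zero part of [f]. *)
Lemma cobound_H1 f : Tinvariant f ->
  exists v, Tinvariant v /\ f - pbr (X H1) v = f@_(0, 0%N, set0) *: mono 0 0 set0.
Proof.
move=> inv; have [tf of_] := inv.
pose c (a : int) (b : nat) : F := (a%:~R - b%:R)^-1.
exists (pdiag (fun k => c k.1.1 k.1.2) f); split.
  split; first by rewrite d_tau_pdiag tf pdiag0.
  by move=> j; rewrite d_odd_pdiag_tt of_ pdiag0.
rewrite gb_H1; apply/malgP => k.
rewrite (mcoeffB k) !mcoeff_pdiag (mcoeffZ _ _ k) mcoeff_mono.
have [fk|nz] := eqVneq f@_k 0.
  by rewrite fk !mulr0 subr0; case: eqP => [e|_]; [rewrite e fk mul0r|rewrite mulr0].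
have [k2 k3] := invariant_coeff inv nz.
case: k k2 k3 nz => [[a b] S] /= -> -> nz; rewrite /c subr0.
have [->|an] := eqVneq a 0.
  by rewrite eqxx mulr1 mul0r subr0.
rewrite mulrA divff ?intr_eq0 // mul1r subrr.
by case: eqP => [[e]|_]; [rewrite e eqxx in an|rewrite mulr0].
Qed.

End Relations.

(** * The derivation L and skew-symmetry of the bracket *)

Section DerivationL.
Context (F : numFieldType).
Implicit Types (A B : P4 F).
Local Notation tp := (@tp F).

(* The outer derivation {log t, .}, up to sign; its flow shifts tau by a
   multiple of 1/t. *)
Definition Lop A := tp (-1) ** pdtau A.

Lemma LopP c A B : Lop (c *: A + B) = c *: Lop A + Lop B.
Proof. by rewrite /Lop d_tauP pmulPr. Qed.
HB.instance Definition _ :=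
  GRing.isLinear.Build F (P4 F) (P4 F) *:%R Lop LopP.

Lemma homogP_tp a : homogP false (tp a).
Proof. by apply: homogPE; rewrite parity_mono cards0. Qed.

Lemma tpC a A : A ** tp a = tp a ** A.
Proof. by rewrite (superpmulC A (@homogP_tp a)). Qed.

Lemma superder_Lop : superder false Lop.
Proof. exact: (superder_mull (@homogP_tp (-1)) (@superder_d_tau F)). Qed.

Lemma d_tau_Lop A : pdtau (Lop A) = Lop (pdtau A).
Proof. exact: d_tau_tp. Qed.

Lemma d_odd_Lop j A : pdodd j (Lop A) = Lop (pdodd j A).
Proof. by rewrite /Lop d_odd_tp d_tau_odd. Qed.

Lemma psign_Lop A : psign (Lop A) = Lop (psign A).
Proof.
by rewrite /Lop parity_pmul parity_d_tau (homogP_psign (@homogP_tp _)) expr0 scale1r.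
Qed.

(** Among the derivatives in the bracket only [pdt] fails to commute with L; the defect comes from
    differentiating 1/t. *)
Lemma d_t_Lop A : pdt (Lop A) + tp (-2) ** pdtau A = Lop (pdt A).
Proof.
rewrite /Lop superder_d_t d_t_mono /= d_t_tau addrAC.
have -> : (-1)%:~R *: pmon F (-1 - 1) 0 set0 = - tp (-2) by rewrite mulrNz scaleN1r.
by rewrite pmulNl addNr add0r.
Qed.

Lemma sub_cancel_mid (V : zmodType) (a b c d m s1 s2 : V) :
  a + (b + m) - (c + m + d) - (s1 + s2) = a - c - s1 + (b - d - s2).
Proof.
rewrite !opprD !addrA.
rewrite (AC 8 ((1*4*7*2*6*8)*(3*5))) /= subrr addr0.
by [].
Qed.

(** The two defects from [d_t_Lop] both equal t^-2 d_tau A d_tau B and enter with opposite signs. *)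
Lemma Lop_pbr A B : Lop (pbr A B) = pbr (Lop A) B + pbr A (Lop B).
Proof.
have LB C D : Lop (C - D) = Lop C - Lop D by exact: (linearB Lop).
rewrite !pbrE !LB !superder_Lop /hparity -!d_tau_Lop -!d_t_Lop pmulDr pmulDl.
have -> : pdtau A ** (tp (-2) ** pdtau B) = tp (-2) ** pdtau A ** pdtau B.
  by rewrite pmulA tpC.
have -> : Lop (\sum_j pdodd j (psign A) ** pdodd (dual j) B) =
    \sum_j pdodd j (psign (Lop A)) ** pdodd (dual j) B
    + \sum_j pdodd j (psign A) ** pdodd (dual j) (Lop B).
  rewrite (linear_sum Lop) -big_split; apply: eq_bigr => j _ /=.
  by rewrite superder_Lop /hparity psign_Lop !d_odd_Lop.
exact: sub_cancel_mid.
Qed.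

Lemma eq_opp0 (V : lmodType F) (x : V) : x = - x -> x = 0.
Proof.
move/eqP; rewrite -subr_eq0 opprK -mulr2n -scaler_nat scaler_eq0 pnatr_eq0.
by move/eqP.
Qed.

Lemma sign_shuffle (V : lmodType F) (Z : V) (p q : bool) :
  (-1) ^+ p *: ((-1) ^+ (~~ p && ~~ q) *: Z) = - ((-1) ^+ (p && q) *: ((-1) ^+ q *: Z)).
Proof.
by case: p; case: q; rewrite /= ?expr0 ?expr1 ?scale1r ?scaleN1r ?scale1r ?scaleN1r ?opprK.
Qed.

Lemma scale2_0 (V : lmodType F) (c : F) (x : V) : 2 *: (0 : V) = c *: x -> c != 0 -> x = 0.
Proof. by rewrite scaler0 => /esym/eqP; rewrite scaler_eq0 => /orP[->|/eqP]. Qed.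

Lemma pmul_homogC p q A B : homogP p A -> homogP q B ->
  A ** B = (-1) ^+ (p && q) *: (B ** A).
Proof.
move=> hA hB; rewrite (superpmulC B hA) /hparity.
by case: p {hA} => /=; [rewrite (homogP_psign hB) pmulZl|rewrite expr0 scale1r].
Qed.

Lemma d_odd_signl p i A B : homogP p A ->
  pdodd i (psign A) ** B = (-1) ^+ p *: (pdodd i A ** B).
Proof. by move=> hA; rewrite (homogP_psign hA) d_oddZ pmulZl. Qed.

Lemma d_odd_skew p q i j A B : homogP p A -> homogP q B ->
  pdodd i (psign A) ** pdodd j B =
  - ((-1) ^+ (p && q) *: (pdodd j (psign B) ** pdodd i A)).
Proof.
move=> hA hB; rewrite (d_odd_signl _ _ hA) (d_odd_signl _ _ hB).
rewrite (pmul_homogC (homogP_dodd (i := i) hA) (homogP_dodd (i := j) hB)).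
exact: sign_shuffle.
Qed.

Lemma skew_shuffle (V : lmodType F) (c : F) (x y z : V) :
  c *: x - c *: y - - (c *: z) = - (c *: (y - x - z)).
Proof. by rewrite opprK -scalerBr -scalerDr -scalerN !opprB (addrC z). Qed.

Lemma pbr_skew p q A B : homogP p A -> homogP q B ->
  pbr A B = - ((-1) ^+ (p && q) *: pbr B A).
Proof.
move=> hA hB; rewrite !pbrE (pmul_homogC (homogP_dtau hA) (homogP_dt hB)).
rewrite (pmul_homogC (homogP_dt hA) (homogP_dtau hB)).
have -> : \sum_j pdodd j (psign A) ** pdodd (dual j) B =
    - ((-1) ^+ (p && q) *: \sum_j pdodd j (psign B) ** pdodd (dual j) A).
  (* Reindexing by the involution [dual] moves the dual index to the other factor. *)
  rewrite (reindex_inj (inv_inj dualK)) scaler_sumr -sumrN; apply: eq_bigr => j _.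
  by rewrite dualK; apply: d_odd_skew.
exact: skew_shuffle.
Qed.

End DerivationL.

(** * Normalisation of a cocycle given by its values on the basis *)

Section Reduction.
Import GammaClosed.
Context (F : numFieldType) (alpha : F).
Implicit Types (A B v : P4 F) (U : gindex -> P4 F).
Local Notation mono := (@pmon F).
Local Notation tp := (@tp F).
Local Notation X := (gb alpha).
Local Notation ev := (GammaClosed.ev alpha).
Local Notation lcocycle := (lcocycle alpha).

Lemma Lop_ev r : Lop (ev r) = ev (rmul (rt (-1)) (rdtau r)).
Proof.
rewrite /Lop (tp_ev alpha); have -> : pdtau (ev r) = ev (rdtau r) by rewrite pdtau.unlock ev_dtau.
by rewrite pprod.unlock ev_mul.
Qed.

(** L is a derivation of the bracket; skew-symmetry rewrites [L X_i, X_j] as the second term of the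
    cocycle identity. *)
Lemma lcocycle_Lop : lcocycle (fun i => Lop (X i)).
Proof.
move=> i j s ij.
have -> : pbr (X i) (Lop (X j)) - (-1) ^+ (gpar i && gpar j) *: pbr (X j) (Lop (X i))
    = Lop (pbr (X i) (X j)).
  rewrite Lop_pbr addrC; congr (_ + _).
  apply/esym/pbr_skew; last exact: (@homogP_gb F alpha j).
  by apply: homogPE; rewrite psign_Lop (homogP_psign (@homogP_gb F alpha i)) (linearZ_LR (@Lop F)).
have -> : 2 *: Lop (pbr (X i) (X j)) = Lop (2 *: pbr (X i) (X j)).
  by rewrite (linearZ_LR (@Lop F)).
rewrite (bracket_isE _ ij) (linear_sum (@Lop F)).
by apply: eq_bigr => x _; rewrite (linearZ_LR (@Lop F)).
Qed.

Lemma Lop_E1 : Lop (X E1) = 0.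
Proof. by rewrite gb_ev Lop_ev; apply: ev0; vm_compute. Qed.

Lemma Lop_Tof j : Lop (X (Tof j)) = 0.
Proof.
by rewrite gb_ev Lop_ev; apply: ev0; case: j => [[|[|[|[|//]]]] lj]; vm_compute.
Qed.

Lemma Lop_H1 : Lop (X H1) = mono 0 0 set0.
Proof.
rewrite gb_ev Lop_ev -[RHS]/(tp 0) (tp_ev alpha); apply: ev_eq; by vm_compute.
Qed.

Definition Tlist := [:: T1; T2; T3; T4].
(** The elements on which the cocycle is already known to vanish when the D_j are treated. *)
Definition good := [:: E1; H1; E2; F2; H2; E3; F3; H3; T1; T2; T3; T4].

(** This and the following [in_] lemmas locate, by computation, each bracket used below in a span
    where the cocycle already vanishes. *)
Lemma in_E1_T j : bracket_in [::] E1 (Tof j).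
Proof. by case: j => [[|[|[|[|//]]]] lj]; vm_compute. Qed.
Lemma in_T_T i j : bracket_in [:: E1] (Tof i) (Tof j).
Proof. by case: i => [[|[|[|[|//]]]] li]; case: j => [[|[|[|[|//]]]] lj]; vm_compute. Qed.
Lemma in_E1_H1 : bracket_in [:: E1] E1 H1. Proof. by vm_compute. Qed.
Lemma in_T_H1 j : bracket_in Tlist (Tof j) H1.
Proof. by case: j => [[|[|[|[|//]]]] lj]; vm_compute. Qed.
Lemma in_E1_k i : is_k i -> bracket_in [::] E1 i.
Proof. by case: i => // _; vm_compute. Qed.
Lemma in_T_k j i : is_k i -> bracket_in Tlist (Tof j) i.
Proof. by case: j => [[|[|[|[|//]]]] lj]; case: i => // _; vm_compute. Qed.
Lemma in_E1_D j : bracket_in Tlist E1 (Dof j).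
Proof. by case: j => [[|[|[|[|//]]]] lj]; vm_compute. Qed.
Lemma in_T_D i j : bracket_in good (Tof i) (Dof j).
Proof. by case: i => [[|[|[|[|//]]]] li]; case: j => [[|[|[|[|//]]]] lj]; vm_compute. Qed.
Lemma in_D_D j : bracket_in [::] (Dof j) (Dof j).
Proof. by case: j => [[|[|[|[|//]]]] lj]; vm_compute. Qed.
Lemma is_H1_D j : bracket_is H1 (Dof j) [:: (-2, 0%N, Dof j)].
Proof. by case: j => [[|[|[|[|//]]]] lj]; vm_compute. Qed.
Lemma gpar_Tof j : gpar (Tof j). Proof. by case: j => [[|[|[|[|//]]]] lj]. Qed.
Lemma gpar_Dof j : gpar (Dof j). Proof. by case: j => [[|[|[|[|//]]]] lj]. Qed.

Lemma zero_nil U k : k \in [::] -> U k = 0. Proof. by rewrite in_nil. Qed.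
Lemma zero_E1 U : U E1 = 0 -> forall k, k \in [:: E1] -> U k = 0.
Proof. by move=> UE k; rewrite inE => /eqP ->. Qed.

Lemma lcocycle_cobsub U v : lcocycle U -> lcocycle (fun i => U i - pbr (X i) v).
Proof.
move=> hU; have -> : (fun i => U i - pbr (X i) v) = (fun i => U i - 1 *: pbr (X i) v).
  by apply/funext => i; rewrite scale1r.
exact: (lcocycle_sub 1 hU (lcocycle_cob alpha v)).
Qed.

(** Turns zeros already obtained into an equation on the next value. *)
Lemma lcocycle_move U s i j : lcocycle U -> bracket_in s i j ->
  (forall k, k \in s -> U k = 0) -> U i = 0 -> pbr (X i) (U j) = 0.
Proof. by move=> hU ij U0 Ui; rewrite (lcocycle_in hU ij U0) Ui pbr0r scaler0. Qed.

Definition T_zero U := forall k, k \in Tlist -> U k = 0.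

Lemma T_zeroP U : (forall j, U (Tof j) = 0) -> T_zero U.
Proof.
move=> h k; rewrite !inE => /or4P[] /eqP->.
- exact: (h (@Ordinal 4 0 isT)).
- exact: (h (@Ordinal 4 1 isT)).
- exact: (h (@Ordinal 4 2 isT)).
- exact: (h (@Ordinal 4 3 isT)).
Qed.

Lemma lcocycle_ET U : lcocycle U -> exists v, let W i := U i - pbr (X i) v in
  W E1 = 0 /\ forall j, W (Tof j) = 0.
Proof.
move=> hU; have [v1 v1E] := cobound_E1 alpha (U E1).
pose V i := U i - pbr (X i) v1.
have hV : lcocycle V := lcocycle_cobsub v1 hU.
have VE : V E1 = 0 by rewrite /V v1E subrr.
have tV j : pdtau (V (Tof j)) = 0.
  by apply: (@E1_eq0 _ alpha); apply: (lcocycle_move hV (in_E1_T j) (@zero_nil V) VE).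
(* [T_i, T_j] is a multiple of E1, where V vanishes, so the cocycle identity is the compatibility
   condition of [koszul]. *)
have oV i j : pdodd i (V (Tof j)) = - pdodd j (V (Tof i)).
  have := lcocycle_in hV (in_T_T i j) (zero_E1 VE).
  rewrite gpar_Tof gpar_Tof expr1 scaleN1r (gb_Tof _ _ (tV _)) (gb_Tof _ _ (tV _)).
  rewrite -pmulNr => /(f_equal (fun A => tp (-1) ** A)).
  by rewrite !tp_mulA addNr !tp0_mul.
(* The factor 1/t compensates the t in the action of T_j. As v2 lies in ker d_tau, the zero at E1 is
   kept. *)
have [||v2 [tv2 ov2]] := @koszul F (fun j => tp (-1) ** V (Tof j)).
- by move=> i; rewrite d_tau_tp tV pmul0r.
- by move=> i j; rewrite !d_odd_tp oV pmulNr.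
exists (v1 + v2) => W; have WV i : W i = V i - pbr (X i) v2.
  by rewrite /W /V pbrDr opprD addrA.
split=> [|j]; rewrite WV.
  by rewrite VE gb_E1 tv2 pmul0r scaler0 !oppr0 addr0.
by rewrite (gb_Tof _ _ tv2) ov2 tp_mulK subrr.
Qed.

Lemma lcocycle_H U : lcocycle U -> U E1 = 0 -> (forall j, U (Tof j) = 0) ->
  exists v x, let W i := U i - pbr (X i) v - x *: Lop (X i) in
  [/\ W E1 = 0, forall j, W (Tof j) = 0 & W H1 = 0].
Proof.
move=> hU UE UT; have T0 := T_zeroP UT.
have tH : pdtau (U H1) = 0.
  by apply: (@E1_eq0 _ alpha); apply: (lcocycle_move hU in_E1_H1 (zero_E1 UE) UE).
have invf : Tinvariant (U H1).
  split; first exact: tH.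
  move=> j; apply: (Tof_eq0 tH); exact: (lcocycle_move hU (in_T_H1 j) T0 (UT j)).
have [v [[tv ov] vE]] := cobound_H1 alpha invf.
(* The scalar is the constant left by [cobound_H1], and L sends H1 to 1. Since v is invariant and L
   kills E1 and the T_j, the earlier zeros persist. *)
exists v, (U H1)@_(0, 0%N, set0) => W; split=> [|j|].
- by rewrite /W UE Lop_E1 gb_E1 tv pmul0r !scaler0 !oppr0 !addr0.
- by rewrite /W UT Lop_Tof (gb_Tof _ _ tv) ov pmul0r scaler0 !oppr0 !addr0.
by rewrite /W vE Lop_H1 subrr.
Qed.

Lemma Dof_ex P : (forall j, P (Dof j)) -> [/\ P D1, P D2, P D3 & P D4].
Proof.
move=> h; split.
- exact: (h (@Ordinal 4 0 isT)).
- exact: (h (@Ordinal 4 1 isT)).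
- exact: (h (@Ordinal 4 2 isT)).
- exact: (h (@Ordinal 4 3 isT)).
Qed.

Lemma lcocycle_k U : lcocycle U -> U E1 = 0 -> (forall j, U (Tof j) = 0) ->
  forall i, is_k i -> U i = 0.
Proof.
move=> hU UE UT; have T0 := T_zeroP UT.
have kinv i : is_k i -> Tinvariant (U i).
  move=> ki; have tU : pdtau (U i) = 0.
    by apply: (@E1_eq0 _ alpha); apply: (lcocycle_move hU (in_E1_k ki) (@zero_nil U) UE).
  split=> // j; apply: (Tof_eq0 tU); exact: (lcocycle_move hU (in_T_k j ki) T0 (UT j)).
(* These elements act trivially on invariants, so U vanishes on their brackets. *)
have kk i j c k : is_k i -> is_k j -> bracket_is i j [:: (c, 0%N, k)] -> c != 0 -> U k = 0.
  move=> ki kj ij c0; have := hU _ _ _ ij.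
  rewrite big_seq1 (gb_k _ ki (kinv j kj)) (gb_k _ kj (kinv i ki)) scaler0 subr0 scaler0.
  by move/esym/eqP; rewrite scaler_eq0 /coef mulr1 intr_eq0 (negPf c0) => /eqP.
case=> // _.
(* The constants are twice the structure constants, as in [bracket_is]. *)
- by apply: (@kk H2 E2 4); vm_compute.
- by apply: (@kk H2 F2 (-4)); vm_compute.
- by apply: (@kk E2 F2 (-2)); vm_compute.
- by apply: (@kk H3 E3 4); vm_compute.
- by apply: (@kk H3 F3 (-4)); vm_compute.
by apply: (@kk E3 F3 2); vm_compute.
Qed.

Lemma lcocycle_zero U : lcocycle U -> U E1 = 0 -> (forall j, U (Tof j) = 0) ->
  U H1 = 0 -> forall i, U i = 0.
Proof.
move=> hU UE UT UH; have T0 := T_zeroP UT; have k0 := lcocycle_k hU UE UT.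
have good0 i : i \in good -> U i = 0.
  rewrite !inE; do 2![case/orP=> [/eqP-> //|]].
  do 6![case/orP=> [/eqP->|]; first by apply: k0].
  by move=> h; apply: T0; rewrite !inE.
have UD j : U (Dof j) = 0.
  have tD : pdtau (U (Dof j)) = 0.
    by apply: (@E1_eq0 _ alpha); apply: (lcocycle_move hU (in_E1_D j) T0 UE).
  have oD i : pdodd i (U (Dof j)) = 0.
    by apply: (Tof_eq0 tD); apply: (lcocycle_move hU (in_T_D i j) good0 (UT i)).
  (* D_j is odd with [D_j, D_j] = 0, so the identity equates D_j acting on its own value with the
     negative of this. On invariants D_j acts as xi_j d_t. *)
  have xD : xi F j ** pdt (U (Dof j)) = 0.
    apply: eq_opp0; have := lcocycle_in hU (in_D_D j) (@zero_nil U).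
    by rewrite gpar_Dof expr1 scaleN1r (gb_Dof _ _ (conj tD oD)).
  (* The j-th odd derivative recovers f from xi_j f when it kills f. *)
  have dD : pdt (U (Dof j)) = 0.
    have := d_odd_xi j j (pdt (U (Dof j))).
    by rewrite xD d_odd0 eqxx scale1r -d_t_odd oD d_t0 pmul0r subr0.
  (* The value is now a constant, hence killed by H1, while [H1, D_j] = -D_j forces the eigenvalue
     -1. *)
  have := hU _ _ _ (is_H1_D j); rewrite big_seq1 UH pbr0r scaler0 subr0 gb_H1.
  have -> : pdiag (fun k => k.1.1%:~R - k.1.2%:R) (U (Dof j)) = 0.
    apply/malgP => k; have := t_d_t (U (Dof j)); have := tau_d_tau (U (Dof j)).
    rewrite tD dD !pmul0r => /(f_equal (mcoeff k)) + /(f_equal (mcoeff k)).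
    by rewrite !mcoeff_pdiag mulrBl => <- <-; rewrite mcoeff0 subrr.
  by move/scale2_0; apply; rewrite /coef mulr1 intr_eq0.
have [U1 U2 U3 U4] := Dof_ex (P := fun i => U i = 0) UD.
have UF : U F1 = 0.
  have D13 : bracket_is D1 D3 [:: (2, 0%N, F1)] by vm_compute.
  have := hU _ _ _ D13; rewrite big_seq1 U1 U3 !pbr0r scaler0 subr0.
  by move/scale2_0; apply; rewrite /coef mulr1 intr_eq0.
have T4 : [/\ U T1 = 0, U T2 = 0, U T3 = 0 & U T4 = 0].
  by split; apply: T0; rewrite !inE eqxx ?orbT.
case: T4 => UT1 UT2 UT3 UT4.
by case=> //; apply: k0.
Qed.

Lemma lcocycleE U : lcocycle U ->
  exists v x, forall i, U i = pbr (X i) v + x *: Lop (X i).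
Proof.
move=> hU; have [v [VE VT]] := lcocycle_ET hU.
have hV := lcocycle_cobsub v hU.
have [v' [x [WE WT WH]]] := lcocycle_H hV VE VT.
have hW := lcocycle_sub x (lcocycle_cobsub v' hV) lcocycle_Lop.
exists (v + v'), x => i; have := lcocycle_zero hW WE WT WH i.
rewrite pbrDr; move: (U i) (pbr (X i) v) (pbr (X i) v') (x *: Lop (X i)) => a b c d.
by move/eqP; rewrite -!addrA -!opprD subr_eq0 => /eqP ->.
Qed.

End Reduction.

(** * The exponential of L and its Leibniz rule *)

Section Deformation.
Context (F : numFieldType).
Implicit Types (A B : P4 F).

(** The coefficient of beta^n in exp (beta L). *)
Definition Lpow n A : P4 F := n`!%:R^-1 *: iter n (@Lop F) A.

Lemma LpowP n c A B : Lpow n (c *: A + B) = c *: Lpow n A + Lpow n B.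
Proof.
have itP : iter n (@Lop F) (c *: A + B) = c *: iter n (@Lop F) A + iter n (@Lop F) B.
  by elim: n => [|n IH] //=; rewrite IH LopP.
by rewrite /Lpow itP; move: (iter _ _ _) (iter _ _ _) => x y; rewrite scalerDr !scalerA (mulrC c).
Qed.

Lemma Lpow0 A : Lpow 0 A = A.
Proof. by rewrite /Lpow fact0 invr1 scale1r. Qed.

Lemma scale_fact (V : lmodType F) n (x : V) :
  n`!%:R^-1 *: x = n.+1%:R *: (n.+1`!%:R^-1 *: x).
Proof.
have n0 : n.+1%:R != 0 :> F by rewrite pnatr_eq0.
by rewrite scalerA factS natrM invfM mulrA divff // mul1r.
Qed.

Lemma Lop_Lpow n A : Lop (Lpow n A) = n.+1%:R *: Lpow n.+1 A.
Proof.
rewrite /Lpow iterS (linearZ_LR (@Lop F)); apply: (scale_fact n).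
Qed.

Lemma Lpow1 A : Lpow 1 A = Lop A.
Proof. by rewrite -{2}(Lpow0 A) Lop_Lpow scale1r. Qed.

Lemma homogP_Lop p A : homogP p A -> homogP p (Lop A).
Proof.
by move/homogP_psign => hA; apply: homogPE; rewrite psign_Lop hA (linearZ_LR (@Lop F)).
Qed.

Lemma homogP_Lpow p n A : homogP p A -> homogP p (Lpow n A).
Proof.
move=> hA; rewrite /Lpow -[_ *: _]addr0; apply: homogPD; last exact: homogP0.
by elim: n => [|n IH] //=; apply: homogP_Lop.
Qed.

(** The factor n + 1 splits as i + (n + 1 - i), and each of the two sums loses the end term of
    weight 0. *)
Lemma leibniz_sum (V : lmodType F) n (f : nat -> nat -> V) :
  \sum_(i < n.+1) (i.+1%:R *: f i.+1 (n - i)%N + (n - i).+1%:R *: f i (n - i).+1) =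
  n.+1%:R *: \sum_(i < n.+2) f i (n.+1 - i)%N.
Proof.
rewrite big_split /=.
have -> : n.+1%:R *: \sum_(i < n.+2) f i (n.+1 - i)%N =
    \sum_(i < n.+2) i%:R *: f i (n.+1 - i)%N
    + \sum_(i < n.+2) (n.+1 - i)%:R *: f i (n.+1 - i)%N.
  rewrite -big_split scaler_sumr; apply: eq_bigr => i _ /=.
  by rewrite -scalerDl -natrD subnKC // -ltnS.
congr (_ + _).
  by rewrite [RHS]big_ord_recl scale0r add0r; apply: eq_bigr => i _; rewrite subSS.
rewrite [RHS]big_ord_recr /= subnn scale0r addr0; apply: eq_bigr => i _.
by rewrite subSn // -ltnS.
Qed.

Lemma Lop_pbr_Lpow i j A B : Lop (pbr (Lpow i A) (Lpow j B)) =
  i.+1%:R *: pbr (Lpow i.+1 A) (Lpow j B) + j.+1%:R *: pbr (Lpow i A) (Lpow j.+1 B).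
Proof.
apply: (etrans (Lop_pbr _ _)); apply: (f_equal2 +%R).
  apply: (etrans (f_equal (fun C => pbr C _) (Lop_Lpow i A))); apply: pbrZl.
apply: (etrans (f_equal (pbr _) (Lop_Lpow j B))); apply: pbrZr.
Qed.

(** Applying L to the identity for n yields n + 1 times the one for n + 1. Together these identities
    say that exp (beta L) preserves the bracket. *)
Lemma Lpow_pbr n A B :
  Lpow n (pbr A B) = \sum_(i < n.+1) pbr (Lpow i A) (Lpow (n - i) B).
Proof.
elim: n => [|n IH]; first by rewrite big_ord1 !Lpow0.
have n0 : n.+1%:R != 0 :> F by rewrite pnatr_eq0.
apply: (scalerI n0); rewrite -Lop_Lpow IH (linear_sum (@Lop F)).
rewrite -(leibniz_sum n (fun i j => pbr (Lpow i A) (Lpow j B))).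
by apply: eq_bigr => i _; apply: Lop_pbr_Lpow.
Qed.

Lemma pproj_add p A B : pproj p (A + B) = pproj p A + pproj p B.
Proof. exact: (linearD (@pdiag F _)). Qed.

Lemma pproj_scale p c A : pproj p (c *: A) = c *: pproj p A.
Proof. exact: (linearZ_LR (@pdiag F _)). Qed.

Lemma pproj_neq p q A : homogP p A -> p != q -> pproj q A = 0.
Proof.
move=> hA pq; apply: (etrans (pproj_homogP q hA)).
by rewrite (negPf pq); exact: scale0r.
Qed.

(** Allows an arbitrary v in a coboundary to be replaced by its homogeneous component. *)
Lemma pproj_pbr p q A B : homogP p A -> pproj (p (+) q) (pbr A B) = pbr A (pproj q B).
Proof.
move=> hA; rewrite -{1}(pprojD q B) pbrDr pproj_add.
rewrite (pproj_id (homogP_pbr hA (@homogP_pproj F q B))).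
rewrite (pproj_neq (homogP_pbr hA (@homogP_pproj F (~~ q) B))); first exact: addr0.
by case: (p); case: (q).
Qed.

End Deformation.

(** * From values on the basis to linear maps on Gamma; even and odd cocycles *)

Section FirstCohomology.
Context (F : numFieldType) (alpha : F).
Local Notation gamma := (gamma alpha).
Local Notation gb := (gb alpha).
Local Notation gelt := (gelt alpha).
Local Notation gbracket := (@gbracket F alpha).
Implicit Types (X Y : gamma) (v : P4 F).

Lemma gval_lin c X Y : gval (c *: X + Y) = c *: gval X + gval Y.
Proof. exact: (linearP (val : gamma -> P4 F)). Qed.

Lemma gval_gelt i : gval (gelt i) = gb i.
Proof. by rewrite gb.unlock. Qed.

Lemma gval_gbracket X Y : gval (gbracket X Y) = pbr (gval X) (gval Y).
Proof. by rewrite pbr.unlock. Qed.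

Lemma homogG_gelt i : homogG (gpar i) (gelt i).
Proof. by rewrite /homogG gval_gelt; apply: homogP_gb. Qed.

Lemma gval_sum (T : Type) (s : seq T) (a : T -> F) (e : T -> gamma) :
  gval (\sum_(x <- s) a x *: e x) = \sum_(x <- s) a x *: gval (e x).
Proof.
elim: s => [|x s IH]; last by rewrite !big_cons gval_lin IH.
rewrite !big_nil; have := gval_lin (-1) 0 0.
by rewrite scaler0 addr0 scaleN1r addNr.
Qed.

Lemma gvalZ c X : gval (c *: X) = c *: gval X.
Proof.
have gval0 : gval (0 : gamma) = 0.
  by have := gval_sum [::] (fun=> 0) (fun x : nat => 0); rewrite !big_nil.
by rewrite -[c *: X]addr0 gval_lin gval0; exact: addr0.
Qed.

Lemma gamma_ext (f g : gamma -> P4 F) : linear f -> linear g ->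
  (forall i, f (gelt i) = g (gelt i)) -> forall X, f X = g X.
Proof.
move=> lf lg fg X; have /asboolP[a Xa] := gvalP X.
have -> : X = \sum_i a i *: gelt i by apply: val_inj; rewrite /= gval_sum.
have f0 : f 0 = 0 by have := lf (-1) 0 0; rewrite scaler0 addr0 scaleN1r addNr.
have g0 : g 0 = 0 by have := lg (-1) 0 0; rewrite scaler0 addr0 scaleN1r addNr.
by elim/big_rec: _ => [|i Y _ IH]; rewrite ?f0 ?g0 // lf lg fg IH.
Qed.

(** The restriction of exp (beta L) to Gamma: [rho 0] is the inclusion and [rho 1] is theta1. *)
Definition rho n X : P4 F := Lpow n (gval X).

Lemma rho_linear n : linear (rho n).
Proof. by move=> c X Y; rewrite /rho gval_lin LpowP. Qed.

HB.instance Definition _ n :=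
  GRing.isLinear.Build F gamma (P4 F) *:%R (rho n) (rho_linear n).

Lemma deforms_rho_rho : deforms_rho (fun n => rho n).
Proof.
split=> [X|n p X|n X Y].
- exact: Lpow0.
- by rewrite addbF; apply: homogP_Lpow.
transitivity (Lpow n (pbr (gval X) (gval Y))); first by rewrite -gval_gbracket.
by rewrite Lpow_pbr pbr.unlock.
Qed.

Lemma rho1 X : rho 1 X = Lop (gval X).
Proof. exact: Lpow1. Qed.

Lemma rho1_value i : rho 1 (gelt i) = theta1_value F i.
Proof.
rewrite rho1 gval_gelt gb_ev Lop_ev.
pose r : seq (int * nat * (int * nat * seq bool)) := match i with
  | D1 => GammaClosed.rmul (GammaClosed.rt (-1)) (GammaClosed.rodd 0)
  | D2 => GammaClosed.rmul (GammaClosed.rt (-1)) (GammaClosed.rodd 1)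
  | D3 => GammaClosed.rmul (GammaClosed.rt (-1)) (GammaClosed.rodd 2)
  | D4 => GammaClosed.rmul (GammaClosed.rt (-1)) (GammaClosed.rodd 3)
  | F1 => GammaClosed.rscale 2 0 (GammaClosed.rmul (GammaClosed.rt (-1)) GammaClosed.rtau)
  | H1 => GammaClosed.rt 0
  | _ => [::] end.
have -> : theta1_value F i = GammaClosed.ev alpha r.
  rewrite /r /theta1_value; case: i {r}; rewrite ?GammaClosed.ev_nil //.
  - by rewrite GammaClosed.ev_scale mulr1 -GammaClosed.ev_mul -GammaClosed.ev_t -GammaClosed.ev_tau.
  - exact: GammaClosed.ev_t.
  - by rewrite -GammaClosed.ev_mul -GammaClosed.ev_t -(GammaClosed.ev_xi alpha 0).
  - by rewrite -GammaClosed.ev_mul -GammaClosed.ev_t -(GammaClosed.ev_xi alpha 1).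
  - by rewrite -GammaClosed.ev_mul -GammaClosed.ev_t -(GammaClosed.ev_eta alpha 0).
  by rewrite -GammaClosed.ev_mul -GammaClosed.ev_t -(GammaClosed.ev_eta alpha 1).
by apply: ev_eq; rewrite /r; case: i {r}; vm_compute.
Qed.

Lemma even_cocycle1_rho1 : even_cocycle1 (rho 1).
Proof.
split=> [p X hX|p q X Y hX hY].
  by rewrite addbF; apply: homogP_Lpow.
transitivity (Lop (pbr (gval X) (gval Y))).
  exact: (etrans (rho1 _) (f_equal _ (gval_gbracket X Y))).
rewrite Lop_pbr addrC; apply: (f_equal2 +%R).
  by rewrite pbr.unlock -rho1; exact: (esym (scale1r _)).
rewrite addbF (andbC q); apply: (etrans (pbr_skew (homogP_Lop hX) hY)).
by rewrite pbr.unlock -rho1.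
Qed.

Lemma gbracket_comb i j s : bracket_is i j s ->
  2 *: gbracket (gelt i) (gelt j) = \sum_(x <- s) coef alpha x *: gelt x.2.
Proof.
move=> ij; apply: val_inj; apply: (etrans (gvalZ _ _)).
apply: (etrans _ (esym (gval_sum _ _ _))).
rewrite gval_gbracket !gval_gelt (bracket_isE alpha ij); apply: eq_bigr => x _.
by rewrite gval_gelt.
Qed.

(** Linearity carries every bracket relation of Gamma over to the values on the basis, where the
    reduction takes place. *)
Lemma lcocycle_linear (u : {linear gamma -> P4 F}) :
  (forall i j, u (gbracket (gelt i) (gelt j)) =
     pbr (gb i) (u (gelt j)) - (-1) ^+ (gpar i && gpar j) *: pbr (gb j) (u (gelt i))) ->
  lcocycle alpha (fun i => u (gelt i)).
Proof.
move=> hu i j s ij; rewrite -hu -linearZ_LR (gbracket_comb ij) linear_sum.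
by apply: eq_bigr => x _; rewrite linearZ_LR.
Qed.

Lemma even_cocycle (z : {linear gamma -> P4 F}) : even_cocycle1 z ->
  exists v x, homogP false v /\ forall X, z X = pbr (gval X) v + x *: rho 1 X.
Proof.
move=> [hz cz].
have hu : lcocycle alpha (fun i => z (gelt i)).
  apply: lcocycle_linear => i j.
  have := cz _ _ _ _ (@homogG_gelt i) (@homogG_gelt j).
  rewrite addbF (andbC (gpar j)) => ->; rewrite pbr.unlock gb.unlock.
  by apply: (f_equal2 (fun A B => A - B)); first exact: scale1r.
have [v [x vx]] := lcocycleE hu.
(* The v found need not be even. Since z and L preserve parity, its odd part contributes nothing. *)
exists (pproj false v), x; split; first exact: homogP_pproj.
apply: gamma_ext => [|c X Y|i]; first exact: linearP.
  rewrite gval_lin rho_linear pbrPl; move: (pbr _ _) (pbr _ _) (rho 1 X) (rho 1 Y) => a b d e.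
  by rewrite !scalerDr !scalerA (mulrC x) addrACA.
have hzi := hz _ _ (@homogG_gelt i); rewrite addbF in hzi.
rewrite rho1 gval_gelt -(pproj_id hzi) (vx i) -(pproj_pbr _ _ (@homogP_gb F alpha i)) addbF.
have hL : homogP (gpar i) (x *: Lop (gb i)).
  rewrite -[_ *: _]addr0; apply: homogPD; last exact: homogP0.
  exact: homogP_Lop (@homogP_gb F alpha i).
by rewrite pproj_add (pproj_id hL).
Qed.

Lemma odd_shuffle (V : lmodType F) (p q : bool) (x y : V) :
  - ((-1) ^+ (true && p) *: ((-1) ^+ p *: x) - (-1) ^+ (q && (p (+) true)) *: ((-1) ^+ q *: y))
  = - x - (-1) ^+ (p && q) *: (- y).
Proof.
case: p; case: q; rewrite /= ?expr0 ?expr1 ?scale1r ?scaleN1r ?scale1r ?scaleN1r;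
  by rewrite ?opprK ?opprB ?opprD ?opprK // addrC.
Qed.

Lemma odd_bracket p q (A B C D : P4 F) : homogP p A -> homogP q B ->
  - psign ((-1) ^+ (true && p) *: pbr A C - (-1) ^+ (q && (p (+) true)) *: pbr B D) =
  pbr A (- psign C) - (-1) ^+ (p && q) *: pbr B (- psign D).
Proof.
move=> /homogP_psign hA /homogP_psign hB.
have eA : psign (pbr A C) = (-1) ^+ p *: pbr A (psign C) by rewrite psign_pbr hA pbrZl.
have eB : psign (pbr B D) = (-1) ^+ q *: pbr B (psign D) by rewrite psign_pbr hB pbrZl.
have pL (c d : F) (x y : P4 F) : psign (c *: x - d *: y) = c *: psign x - d *: psign y.
  apply: (etrans (parityP c x (- (d *: y)))).
  apply: (f_equal (fun w => c *: psign x + w)).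
  apply: (etrans (parityN _)); apply: (f_equal -%R); apply: parityZ.
apply: (etrans (f_equal -%R (pL _ _ _ _))); rewrite eA eB (pbrNr A) (pbrNr B).
by apply: odd_shuffle.
Qed.

(** L preserves parity, so its multiple in the normal form drops out on projecting to the parity
    shifted by one: all odd classes are zero. *)
Lemma odd_cocycle (z : {linear gamma -> P4 F}) :
  homog_cocycle (@homogG F alpha) (@homogP F) gbracket (@pbracket F) (@gval F alpha) true z ->
  homog_coboundary (@homogG F alpha) (@homogP F) (@pbracket F) (@gval F alpha) true z.
Proof.
(* As z is odd, u is X |-> (-1)^p(X) z X on homogeneous X, which satisfies the even identity by
   [odd_bracket]. *)
move=> [hz cz]; pose u : {linear gamma -> P4 F} := \- (@psign F \o z).
have uE X : u X = - psign (z X) by [].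
have hu : lcocycle alpha (fun i => u (gelt i)).
  apply: lcocycle_linear => i j; rewrite !uE.
  rewrite (cz _ _ _ _ (@homogG_gelt i) (@homogG_gelt j)).
  have := odd_bracket (z (gelt j)) (z (gelt i)) (@homogP_gb F alpha i) (@homogP_gb F alpha j).
  by rewrite pbr.unlock gb.unlock.
have [v [x vx]] := lcocycleE hu.
have uv X : u X = pbr (gval X) (pproj true v).
  move: X; apply: gamma_ext => [|c X Y|i]; first exact: linearP.
    by rewrite gval_lin pbrPl.
  have hui : homogP (gpar i (+) true) (u (gelt i)).
    have /homogP_psign e := hz _ _ (@homogG_gelt i).
    rewrite uE e -scaleNr -[_ *: _]addr0; apply: homogPD; last exact: homogP0.
    exact: (hz _ _ (@homogG_gelt i)).
  rewrite -(pproj_id hui) (vx i) gval_gelt -(pproj_pbr _ _ (@homogP_gb F alpha i)).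
  have hL := homogP_Lop (@homogP_gb F alpha i).
  rewrite pproj_add pproj_scale (pproj_neq hL); last by case: (gpar i).
  by rewrite scaler0 addr0.
exists (pproj true v); first exact: homogP_pproj.
move=> p X hX; have := uv X; rewrite uE (homogP_psign (hz _ _ hX)) pbr.unlock => <-.
move: (z X) => w; case: p {hX} => /=.
  by rewrite expr0 expr1 scale1r scaleN1r opprK.
by rewrite expr0 expr1 scale1r scaleN1r opprK.
Qed.

Lemma spans_H1_rho1 : spans_H1 (rho 1).
Proof.
split=> [_|z [z0 [z1 [hz0 hz1 ->]]]].
  exists (rho 1), (\0 : {linear gamma -> P4 F}); split.
  - exact: even_cocycle1_rho1.
  - split=> [p X _|p q X Y _ _]; first exact: homogP0.
    have p0 A : pbracket A 0 = 0 :> P4 F by have := pbr0r A; rewrite pbr.unlock.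
    by rewrite /= !p0 !scaler0 subr0.
  by apply/funext => X; exact: (esym (addr0 _)).
have [v [x [hv vx]]] := even_cocycle hz0.
exists (fun=> x), (z0 \- x \*: rho 1), z1; split.
- exists v => // p X hX; transitivity (pbr (gval X) v).
    by rewrite /= vx addrK.
  by rewrite andbF expr0 scale1r pbr.unlock.
- exact: odd_cocycle.
by apply/funext => X; rewrite big_ord1; exact: addrAC.
Qed.

Lemma free_rho1 : free_mod (@coboundaries1 F alpha) (fun _ : 'I_1 => rho 1 : gamma -> P4 F).
Proof.
move=> a [c0 [c1 [[v0 hv0 e0] [v1 hv1 e1]]]] /(congr1 (fun f => f (gelt H1))).
rewrite big_ord1 => e i; rewrite (ord1 i).
have {}e : a ord0 *: rho 1 (gelt H1) = c0 (gelt H1) + c1 (gelt H1) by exact: e.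
have {}e : a ord0 *: pmon F 0 0 set0 = 1 *: pbr (gb H1) v0 + 1 *: pbr (gb H1) v1.
  transitivity (a ord0 *: rho 1 (gelt H1)); first by rewrite rho1 gval_gelt Lop_H1.
  rewrite e (e0 _ _ (@homogG_gelt H1)) (e1 _ _ (@homogG_gelt H1)).
  by rewrite pbr.unlock gb.unlock.
(* The monomial 1 has weight 0 under H1, so no coboundary has a constant term at H1, whereas [rho 1]
   takes the value 1 there. *)
have h v : (pbr (gb H1) v)@_(0, 0%N, set0) = 0.
  by rewrite gb_H1 mcoeff_pdiag subrr mul0r.
transitivity ((a ord0 *: pmon F 0 0 set0)@_(0, 0%N, set0)).
  apply: (etrans _ (esym (mcoeffZ _ _ _))).
  by rewrite mcoeff_mono eqxx mulr1.
rewrite e; apply: (etrans (mcoeffP 1 _ _ _)); rewrite h mulr0 add0r.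
by apply: (etrans (mcoeffZ _ _ _)); rewrite h mulr0.
Qed.

End FirstCohomology.

(** * Specialisation to the complex numbers *)

Local Open Scope complex_scope.

Theorem theorem4p3 (R : realType) (alpha : R[i]) :
  dim_H1 alpha 1 /\
  exists theta1 : {linear gamma alpha -> P4 R[i]},
    [/\ forall i : gindex, theta1 (gelt alpha i) = theta1_value _ i,
        even_cocycle1 theta1,
        spans_H1 theta1
      & exists rho : nat -> {linear gamma alpha -> P4 R[i]},
          deforms_rho rho /\ rho 1%N =1 theta1].
Proof.
split.
  exists (fun=> @rho R[i] alpha 1 : gamma alpha -> P4 R[i]).
  by split; [exact: spans_H1_rho1|exact: free_rho1].
exists (@rho R[i] alpha 1); split.
- exact: rho1_value.
- exact: even_cocycle1_rho1.
- exact: spans_H1_rho1.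
by exists (fun n => @rho R[i] alpha n); split; [exact: deforms_rho_rho|].
Qed.
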